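(* Let $V$ be an $L$-module with $\dim V=3$. Then $V$ is indecomposable if and only if $V$ is isomorphic to one, and only one, of $\mathcal{V}_a^3$, $\mathcal{C}^3_a$, $\mathcal{E}^3_{1,a}$, $\mathcal{E}^3_{2,a}$ or $\mathcal{E}^3_{3,a,b}$, for unique $a,b\in\Bbbk^{\times}$.
   Context: $\Bbbk$ is an algebraically closed field of characteristic $0$. $L$ is the $\Bbbk$-algebra generated by $y$ and $g^{\pm 1}$ with relations $gg^{-1}=g^{-1}g=1$ and $gyg^{-1}=-y$. $e_1,e_2,e_3$ is the canonical basis of $\Bbbk^3$. For $a,b\in\Bbbk^\times$ define the following $L$-modules on $\Bbbk^3$. $\mathcal{V}^3_a$: $g$ acts by the Jordan block of size $3$ with eigenvalue $a$, $y$ acts by $0$. $\mathcal{C}^3_a$: $ge_1=ae_1$, $ge_2=ae_2$, $ge_3=-ae_3$; $ye_1=0$, $ye_2=e_3$, $ye_3=e_1$. In $\mathcal{E}^3_{1,a},\mathcal{E}^3_{2,a},\mathcal{E}^3_{3,a,b}$: $ge_1=ae_1$, $ge_2=e_1+ae_2$, $ge_3=-ae_3$, and $y$ acts by: $\mathcal{E}^3_{1,a}$: $ye_1=ye_2=0$, $ye_3=e_1$; $\mathcal{E}^3_{2,a}$: $ye_1=0$, $ye_2=e_3$, $ye_3=0$; $\mathcal{E}^3_{3,a,b}$: $ye_1=0$, $ye_2=e_3$, $ye_3=be_1$. *)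

(* Defs.v *)
From HB Require Import structures.
From mathcomp Require Import all_boot all_order all_algebra.
From mathcomp Require Import boolp.

Set Implicit Arguments.
Unset Strict Implicit.
Unset Printing Implicit Defensive.

Import GRing.Theory.
Local Open Scope ring_scope.
Local Open Scope quotient_scope.

(* The library has no free noncommutative algebras, so the presented algebra
   k<y, g, g^-1 | g g^-1 = g^-1 g = 1, g y g^-1 = - y> is built as the quotient
   of the formal expressions in the generators by the smallest congruence
   containing the axioms of unital associative k-algebras and the relations.
   [Cst c] stands for c times the unit. *)
Inductive Lterm (k : Type) : Type :=
| Cst of k
| TY
| TG
| TGinv
| TAdd of Lterm k & Lterm k
| TMul of Lterm k & Lterm k.

Arguments TY {k}.
Arguments TG {k}.
Arguments TGinv {k}.

HB.instance Definition _ (k : Type) := gen_eqMixin (Lterm k).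
HB.instance Definition _ (k : Type) := gen_choiceMixin (Lterm k).

Inductive Leqv (k : fieldType) : Lterm k -> Lterm k -> Prop :=
| Leqv_refl x : Leqv x x
| Leqv_sym x y : Leqv x y -> Leqv y x
| Leqv_trans x y z : Leqv x y -> Leqv y z -> Leqv x z
| Leqv_add x x' y y' : Leqv x x' -> Leqv y y' -> Leqv (TAdd x y) (TAdd x' y')
| Leqv_mul x x' y y' : Leqv x x' -> Leqv y y' -> Leqv (TMul x y) (TMul x' y')
| Leqv_addA x y z : Leqv (TAdd x (TAdd y z)) (TAdd (TAdd x y) z)
| Leqv_addC x y : Leqv (TAdd x y) (TAdd y x)
| Leqv_add0 x : Leqv (TAdd (Cst 0) x) x
| Leqv_mulA x y z : Leqv (TMul x (TMul y z)) (TMul (TMul x y) z)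
| Leqv_mul1l x : Leqv (TMul (Cst 1) x) x
| Leqv_mul1r x : Leqv (TMul x (Cst 1)) x
| Leqv_mulDl x y z :
    Leqv (TMul (TAdd x y) z) (TAdd (TMul x z) (TMul y z))
| Leqv_mulDr x y z :
    Leqv (TMul x (TAdd y z)) (TAdd (TMul x y) (TMul x z))
| Leqv_mul0 x : Leqv (TMul (Cst 0) x) (Cst 0)
| Leqv_cstD c d : Leqv (Cst (c + d)) (TAdd (Cst c) (Cst d))
| Leqv_cstM c d : Leqv (Cst (c * d)) (TMul (Cst c) (Cst d))
| Leqv_cstC c x : Leqv (TMul (Cst c) x) (TMul x (Cst c))
| Leqv_gV : Leqv (TMul TG TGinv) (Cst 1)
| Leqv_Vg : Leqv (TMul TGinv TG) (Cst 1)
| Leqv_gyV : Leqv (TMul (TMul TG TY) TGinv) (TMul (Cst (-1)) TY).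

Definition Leqb (k : fieldType) : rel (Lterm k) := fun x y => `[< Leqv x y >].

Lemma Leqb_refl (k : fieldType) : reflexive (@Leqb k).
Proof. by move=> x; apply/asboolP; exact: Leqv_refl. Qed.

Lemma Leqb_sym (k : fieldType) : symmetric (@Leqb k).
Proof. by move=> x y; apply/asboolP/asboolP; exact: Leqv_sym. Qed.

Lemma Leqb_trans (k : fieldType) : transitive (@Leqb k).
Proof.
by move=> y x z /asboolP xy /asboolP yz; apply/asboolP; exact: Leqv_trans yz.
Qed.

Canonical Leqb_equiv (k : fieldType) :=
  EquivRel (@Leqb k) (@Leqb_refl k) (@Leqb_sym k) (@Leqb_trans k).

Definition L (k : fieldType) := {eq_quot (@Leqb k)}.

HB.instance Definition _ (k : fieldType) :=
  Choice.copy (L k) {eq_quot (@Leqb k)}.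
HB.instance Definition _ (k : fieldType) :=
  EqQuotient.copy (L k) {eq_quot (@Leqb k)}.

Section Algebra.
Variable k : fieldType.
Implicit Types x y z : L k.

Lemma Lpi_eq (s t : Lterm k) : (\pi_(L k) s = \pi_(L k) t) <-> Leqv s t.
Proof.
split=> [/eqmodP /asboolP //|st]; apply/eqmodP; exact/asboolP.
Qed.

Lemma Lrepr_pi (s : Lterm k) : Leqv (repr (\pi_(L k) s)) s.
Proof. by apply/Lpi_eq; rewrite reprK. Qed.

Definition Ladd x y : L k := \pi_(L k) (TAdd (repr x) (repr y)).
Definition Lmul x y : L k := \pi_(L k) (TMul (repr x) (repr y)).
Definition Lcst (c : k) : L k := \pi_(L k) (Cst c).
Definition Lopp x : L k := Lmul (Lcst (-1)) x.

Lemma LaddE (s t : Lterm k) :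
  Ladd (\pi_(L k) s) (\pi_(L k) t) = \pi_(L k) (TAdd s t).
Proof. by apply/Lpi_eq/Leqv_add; exact: Lrepr_pi. Qed.

Lemma LmulE (s t : Lterm k) :
  Lmul (\pi_(L k) s) (\pi_(L k) t) = \pi_(L k) (TMul s t).
Proof. by apply/Lpi_eq/Leqv_mul; exact: Lrepr_pi. Qed.

Lemma Lpi_surj x : exists s : Lterm k, x = \pi_(L k) s.
Proof. by exists (repr x); rewrite reprK. Qed.

Lemma LaddA : associative Ladd.
Proof.
move=> x y z; have [[s ->] [t ->] [u ->]] :=
  And3 (Lpi_surj x) (Lpi_surj y) (Lpi_surj z).
by rewrite !LaddE; apply/Lpi_eq/Leqv_addA.
Qed.

Lemma LaddC : commutative Ladd.
Proof.
move=> x y; have [[s ->] [t ->]] := conj (Lpi_surj x) (Lpi_surj y).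
by rewrite !LaddE; apply/Lpi_eq/Leqv_addC.
Qed.

Lemma Ladd0 : left_id (Lcst 0) Ladd.
Proof.
by move=> x; have [s ->] := Lpi_surj x; rewrite LaddE; apply/Lpi_eq/Leqv_add0.
Qed.

Lemma LmulA : associative Lmul.
Proof.
move=> x y z; have [[s ->] [t ->] [u ->]] :=
  And3 (Lpi_surj x) (Lpi_surj y) (Lpi_surj z).
by rewrite !LmulE; apply/Lpi_eq/Leqv_mulA.
Qed.

Lemma Lmul1l : left_id (Lcst 1) Lmul.
Proof.
by move=> x; have [s ->] := Lpi_surj x; rewrite LmulE; apply/Lpi_eq/Leqv_mul1l.
Qed.

Lemma Lmul1r : right_id (Lcst 1) Lmul.
Proof.
by move=> x; have [s ->] := Lpi_surj x; rewrite LmulE; apply/Lpi_eq/Leqv_mul1r.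
Qed.

Lemma LmulDl : left_distributive Lmul Ladd.
Proof.
move=> x y z; have [[s ->] [t ->] [u ->]] :=
  And3 (Lpi_surj x) (Lpi_surj y) (Lpi_surj z).
by rewrite LaddE !LmulE LaddE; apply/Lpi_eq/Leqv_mulDl.
Qed.

Lemma LmulDr : right_distributive Lmul Ladd.
Proof.
move=> x y z; have [[s ->] [t ->] [u ->]] :=
  And3 (Lpi_surj x) (Lpi_surj y) (Lpi_surj z).
by rewrite LaddE !LmulE LaddE; apply/Lpi_eq/Leqv_mulDr.
Qed.

Lemma Lmul0 x : Lmul (Lcst 0) x = Lcst 0.
Proof.
by have [s ->] := Lpi_surj x; rewrite LmulE; apply/Lpi_eq/Leqv_mul0.
Qed.

Lemma LcstD c d : Lcst (c + d) = Ladd (Lcst c) (Lcst d).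
Proof. by rewrite LaddE; apply/Lpi_eq/Leqv_cstD. Qed.

Lemma LcstM c d : Lcst (c * d) = Lmul (Lcst c) (Lcst d).
Proof. by rewrite LmulE; apply/Lpi_eq/Leqv_cstM. Qed.

Lemma LcstC c x : Lmul (Lcst c) x = Lmul x (Lcst c).
Proof.
by have [s ->] := Lpi_surj x; rewrite !LmulE; apply/Lpi_eq/Leqv_cstC.
Qed.

Lemma LaddN : left_inverse (Lcst 0) Lopp Ladd.
Proof.
move=> x; rewrite -[X in Ladd _ X](Lmul1l x) /Lopp -LmulDl -LcstD.
by rewrite addNr Lmul0.
Qed.

End Algebra.

HB.instance Definition _ (k : fieldType) :=
  GRing.isZmodule.Build (L k) (@LaddA k) (@LaddC k) (@Ladd0 k) (@LaddN k).

(* Elements of an algebra satisfying the defining relations of L. *)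
Record Ldata (k : fieldType) (A : algType k) := MkLdata {
  Ld_y : A;
  Ld_g : A;
  Ld_gi : A;
  Ld_gV : Ld_g * Ld_gi = 1;
  Ld_Vg : Ld_gi * Ld_g = 1;
  Ld_gyV : Ld_g * Ld_y * Ld_gi = - Ld_y }.

Section Eval.
Variables (k : fieldType) (A : algType k) (d : Ldata A).

Fixpoint Leval (t : Lterm k) : A :=
  match t with
  | Cst c => c%:A
  | TY => Ld_y d
  | TG => Ld_g d
  | TGinv => Ld_gi d
  | TAdd s t => Leval s + Leval t
  | TMul s t => Leval s * Leval t
  end.

Lemma Leval_eqv s t : Leqv s t -> Leval s = Leval t.
Proof.
elim=> {s t} //=.
- by move=> x y z _ -> _ ->.
- by move=> x x' y y' _ -> _ ->.
- by move=> x x' y y' _ -> _ ->.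
- by move=> x y z; rewrite addrA.
- by move=> x y; rewrite addrC.
- by move=> x; rewrite scale0r add0r.
- by move=> x y z; rewrite mulrA.
- by move=> x; rewrite scale1r mul1r.
- by move=> x; rewrite scale1r mulr1.
- by move=> x y z; rewrite mulrDl.
- by move=> x y z; rewrite mulrDr.
- by move=> x; rewrite scale0r mul0r.
- by move=> b c; rewrite scalerDl.
- by move=> b c; rewrite -scalerAl mul1r scalerA.
- by move=> c x; rewrite -scalerAl -scalerAr mul1r mulr1.
- by rewrite scale1r Ld_gV.
- by rewrite scale1r Ld_Vg.
- by rewrite Ld_gyV scaleN1r mulN1r.
Qed.

Definition Llift (x : L k) : A := Leval (repr x).

Lemma Llift_pi t : Llift (\pi_(L k) t) = Leval t.
Proof. exact/Leval_eqv/Lrepr_pi. Qed.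

End Eval.

Lemma Ltriv_gV (k : fieldType) : (1 : k^o) * 1 = 1. Proof. exact: mulr1. Qed.
Lemma Ltriv_gyV (k : fieldType) : (1 : k^o) * 0 * 1 = - 0.
Proof. by rewrite mulr0 mul0r oppr0. Qed.

Lemma L_nontrivial (k : fieldType) : Lcst (1 : k) != 0 :> L k.
Proof.
pose d := MkLdata (@Ltriv_gV k) (@Ltriv_gV k) (@Ltriv_gyV k).
apply/eqP=> /(congr1 (Llift d)).
by rewrite !Llift_pi /= scale0r scale1r => /eqP; rewrite oner_eq0.
Qed.

HB.instance Definition _ (k : fieldType) :=
  GRing.Zmodule_isNzRing.Build (L k) (@LmulA k) (@Lmul1l k) (@Lmul1r k)
    (@LmulDl k) (@LmulDr k) (@L_nontrivial k).

Section Scale.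
Variable k : fieldType.
Implicit Types (c d : k) (x y : L k).

Definition Lscale c x : L k := Lcst c * x.

Lemma LscaleA c d x : Lscale c (Lscale d x) = Lscale (c * d) x.
Proof. by rewrite /Lscale mulrA [Lcst (c * d)]LcstM. Qed.

Lemma Lscale1 : left_id 1 Lscale.
Proof. by move=> x; exact: Lmul1l. Qed.

Lemma LscaleDr : right_distributive Lscale +%R.
Proof. by move=> c x y; exact: mulrDr. Qed.

Lemma LscaleDl x : {morph Lscale^~ x : c d / c + d}.
Proof. by move=> c d; rewrite /Lscale [Lcst (c + d)]LcstD; exact: mulrDl. Qed.

End Scale.

HB.instance Definition _ (k : fieldType) :=
  GRing.Zmodule_isLmodule.Build k (L k)
    (@LscaleA k) (@Lscale1 k) (@LscaleDr k) (@LscaleDl k).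

Lemma LscaleAl (k : fieldType) (c : k) (x y : L k) :
  c *: (x * y) = (c *: x) * y.
Proof. exact: mulrA. Qed.

HB.instance Definition _ (k : fieldType) :=
  GRing.Lmodule_isLalgebra.Build k (L k) (@LscaleAl k).

Lemma LscaleAr (k : fieldType) (c : k) (x y : L k) :
  c *: (x * y) = x * (c *: y).
Proof.
rewrite -[LHS]/(Lcst c * (x * y)) -[c *: y]/(Lcst c * y) !mulrA.
by congr (_ * _); exact: LcstC.
Qed.

HB.instance Definition _ (k : fieldType) :=
  GRing.Lalgebra_isAlgebra.Build k (L k) (@LscaleAr k).

Definition Ly (k : fieldType) : L k := \pi_(L k) TY.
Definition Lg (k : fieldType) : L k := \pi_(L k) TG.
Definition Lgi (k : fieldType) : L k := \pi_(L k) TGinv.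

Lemma LgV (k : fieldType) : Lg k * Lgi k = 1.
Proof. by rewrite -[LHS]/(Lmul _ _) LmulE; apply/Lpi_eq/Leqv_gV. Qed.

Lemma LVg (k : fieldType) : Lgi k * Lg k = 1.
Proof. by rewrite -[LHS]/(Lmul _ _) LmulE; apply/Lpi_eq/Leqv_Vg. Qed.

Lemma LgyV (k : fieldType) : Lg k * Ly k * Lgi k = - Ly k.
Proof.
transitivity (Lmul (Lmul (Lg k) (Ly k)) (Lgi k)) => //.
transitivity (Lmul (Lcst (-1)) (Ly k)) => //.
rewrite [Lmul (Lg k) _]LmulE [LHS]LmulE [RHS]LmulE.
by apply/Lpi_eq; exact: Leqv_gyV.
Qed.

Section LiftMorphism.
Variables (k : fieldType) (A : algType k) (d : Ldata A).

Lemma Llift_linear : linear (Llift d).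
Proof.
move=> c x y; have [[s ->] [t ->]] := conj (Lpi_surj x) (Lpi_surj y).
rewrite -[_ + _]/(Ladd (Lmul (Lcst c) _) _) LmulE LaddE !Llift_pi /=.
by rewrite -scalerAl mul1r.
Qed.

Lemma Llift_monoid : monoid_morphism (Llift d).
Proof.
split=> [|x y]; first by rewrite Llift_pi /= scale1r.
have [[s ->] [t ->]] := conj (Lpi_surj x) (Lpi_surj y).
by rewrite -[_ * _]/(Lmul _ _) LmulE !Llift_pi.
Qed.

HB.instance Definition _ :=
  GRing.isLinear.Build k (L k) A *:%R (Llift d) Llift_linear.
HB.instance Definition _ :=
  GRing.isMonoidMorphism.Build (L k) A (Llift d) Llift_monoid.

Lemma Llift_y : Llift d (Ly k) = Ld_y d. Proof. by rewrite Llift_pi. Qed.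
Lemma Llift_g : Llift d (Lg k) = Ld_g d. Proof. by rewrite Llift_pi. Qed.
Lemma Llift_gi : Llift d (Lgi k) = Ld_gi d. Proof. by rewrite Llift_pi. Qed.

(* [Llift d] is the unique algebra morphism with these values: L has the
   universal property of the presented algebra. *)
Lemma Llift_unique (f : {lrmorphism L k -> A}) :
  f (Ly k) = Ld_y d -> f (Lg k) = Ld_g d -> f (Lgi k) = Ld_gi d ->
  f =1 Llift d.
Proof.
move=> fy fg fgi x; have [s ->] := Lpi_surj x; rewrite Llift_pi.
elim: s => [c||||s IHs t IHt|s IHs t IHt] //=.
- have -> : \pi_(L k) (Cst c) = c%:A by rewrite -[c%:A]mulr1 -[LHS]mulr1
    -scalerAl mul1r -[RHS]/(Lcst c * 1).
  by rewrite linearZ /= rmorph1.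
- have -> : \pi_(L k) (TAdd s t) = \pi_(L k) s + \pi_(L k) t.
    by rewrite -LaddE.
  by rewrite -IHs -IHt -raddfD.
- have -> : \pi_(L k) (TMul s t) = \pi_(L k) s * \pi_(L k) t.
    by rewrite -LmulE.
  by rewrite -IHs -IHt -rmorphM.
Qed.

End LiftMorphism.

Definition Lmod3 (k : fieldType) (d : Ldata 'M[k]_3) : Type := 'cV[k]_3.

HB.instance Definition _ (k : fieldType) (d : Ldata 'M[k]_3) :=
  GRing.Zmodule.copy (Lmod3 d) 'cV[k]_3.

Section Lmod3.
Variables (k : fieldType) (d : Ldata 'M[k]_3).

Definition Lact (x : L k) (v : Lmod3 d) : Lmod3 d := Llift d x *m v.

Lemma LactA x y v : Lact x (Lact y v) = Lact (x * y) v.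
Proof. by rewrite /Lact rmorphM mulmxA. Qed.

Lemma Lact1 : left_id 1 Lact.
Proof. by move=> v; rewrite /Lact rmorph1 mul1mx. Qed.

Lemma LactDr : right_distributive Lact +%R.
Proof. by move=> x u v; exact: mulmxDr. Qed.

Lemma LactDl v : {morph Lact^~ v : x y / x + y}.
Proof. by move=> x y; rewrite /Lact rmorphD; exact: mulmxDl. Qed.

HB.instance Definition _ :=
  GRing.Zmodule_isLmodule.Build (L k) (Lmod3 d) LactA Lact1 LactDr LactDl.

End Lmod3.

(* The matrix of the endomorphism e_1 |-> u1, e_2 |-> u2, e_3 |-> u3 of k^3. *)
Definition endo3 (k : fieldType) (u1 u2 u3 : 'cV[k]_3) : 'M[k]_3 :=
  \matrix_(i, j) (nth 0 [:: u1; u2; u3] j) i 0.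

Section Families.
Variable k : fieldType.

Notation e1 := (delta_mx 0 0 : 'cV[k]_3).
Notation e2 := (delta_mx 1 0 : 'cV[k]_3).
Notation e3 := (delta_mx 2 0 : 'cV[k]_3).

Definition gV (a : k) := endo3 (a *: e1) (e1 + a *: e2) (e2 + a *: e3).
Definition gC (a : k) := endo3 (a *: e1) (a *: e2) (- a *: e3).
Definition gE (a : k) := endo3 (a *: e1) (e1 + a *: e2) (- a *: e3).
Definition yV : 'M[k]_3 := endo3 0 0 0.
Definition yC := endo3 0 e3 e1.
Definition yE1 := endo3 0 0 e1.
Definition yE2 := endo3 0 e3 0.
Definition yE3 (b : k) := endo3 0 e3 (b *: e1).

Variant ord3_spec : 'I_3 -> Type :=
| Ord3_0 : ord3_spec 0
| Ord3_1 : ord3_spec 1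
| Ord3_2 : ord3_spec 2.

Lemma ord3P (i : 'I_3) : ord3_spec i.
Proof.
by case: i => -[|[|[|i]]] // lti;
  [have -> : Ordinal lti = 0 by apply/val_inj|
   have -> : Ordinal lti = 1 by apply/val_inj|
   have -> : Ordinal lti = 2 by apply/val_inj]; constructor.
Qed.

Lemma endo3_upper_unit (u1 u2 u3 : 'cV[k]_3) :
  u1 1 0 = 0 -> u1 2 0 = 0 -> u2 2 0 = 0 ->
  u1 0 0 != 0 -> u2 1 0 != 0 -> u3 2 0 != 0 ->
  endo3 u1 u2 u3 \is a GRing.unit.
Proof.
move=> u11 u12 u22 n0 n1 n2.
rewrite -[_ \is a _]/(_ \in unitmx) unitmxE -det_tr det_trig; last first.
  by apply/is_trig_mxP=> i j; case: (ord3P i); case: (ord3P j); rewrite // !mxE.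
rewrite unitfE; apply/prodf_neq0 => i _; rewrite !mxE.
by case: (ord3P i).
Qed.

Definition entryE := (mxE, mulr0, mulr1, addr0, add0r, eqxx).

Lemma gV_unit (a : k) : a != 0 -> gV a \is a GRing.unit.
Proof. by move=> a0; apply: endo3_upper_unit; rewrite !entryE /= ?entryE. Qed.

Lemma gC_unit (a : k) : a != 0 -> gC a \is a GRing.unit.
Proof.
move=> a0; apply: endo3_upper_unit; rewrite !entryE /= ?entryE //.
by rewrite oppr_eq0.
Qed.

Lemma gE_unit (a : k) : a != 0 -> gE a \is a GRing.unit.
Proof.
move=> a0; apply: endo3_upper_unit; rewrite !entryE /= ?entryE //.
by rewrite oppr_eq0.
Qed.

Definition anticomm3 (G Y : 'M[k]_3) := G * Y = - (Y * G).

Lemma endo3_col (u1 u2 u3 : 'cV[k]_3) (j : 'I_3) :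
  endo3 u1 u2 u3 *m delta_mx j 0 = nth 0 [:: u1; u2; u3] j.
Proof. by rewrite -colE; apply/colP=> i; rewrite !mxE. Qed.

Lemma mul_endo3 (M : 'M[k]_3) (u1 u2 u3 : 'cV[k]_3) :
  M * endo3 u1 u2 u3 = endo3 (M *m u1) (M *m u2) (M *m u3).
Proof.
apply/matrixP=> i j; rewrite !mxE; case: (ord3P j) => /=; rewrite !mxE;
  by apply: eq_bigr => l _; rewrite !mxE.
Qed.

Lemma opp_endo3 (u1 u2 u3 : 'cV[k]_3) :
  - endo3 u1 u2 u3 = endo3 (- u1) (- u2) (- u3).
Proof. by apply/matrixP=> i j; rewrite !mxE; case: (ord3P j); rewrite mxE. Qed.

Lemma anticomm3V a : anticomm3 (gV a) yV.
Proof.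
have -> : yV = 0.
  by apply/matrixP=> i j; rewrite !mxE; case: (ord3P j); rewrite mxE.
by rewrite /anticomm3 mulr0 mul0r oppr0.
Qed.

Lemma anticomm3C a : anticomm3 (gC a) yC.
Proof.
rewrite /anticomm3 /gC /yC !mul_endo3 opp_endo3.
by rewrite !(mulmxDr, mulmx0, =^~ scalemxAr, endo3_col) /= !scaler0 !oppr0
  !scaleNr opprK.
Qed.

Lemma anticomm3E1 a : anticomm3 (gE a) yE1.
Proof.
rewrite /anticomm3 /gE /yE1 !mul_endo3 opp_endo3.
by rewrite !(mulmxDr, mulmx0, =^~ scalemxAr, endo3_col) /= !scaler0 addr0
  !oppr0 scaleNr opprK.
Qed.

Lemma anticomm3E2 a : anticomm3 (gE a) yE2.
Proof.
rewrite /anticomm3 /gE /yE2 !mul_endo3 opp_endo3.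
by rewrite !(mulmxDr, mulmx0, =^~ scalemxAr, endo3_col) /= !scaler0 add0r
  !oppr0 scaleNr.
Qed.

Lemma anticomm3E3 a b : anticomm3 (gE a) (yE3 b).
Proof.
rewrite /anticomm3 /gE /yE3 !mul_endo3 opp_endo3.
rewrite !(mulmxDr, mulmx0, =^~ scalemxAr, endo3_col) /= !scaler0 add0r.
by rewrite !oppr0 !scaleNr opprK !scalerA mulrC.
Qed.

Lemma Ldata_of_subproof (G Y : 'M[k]_3) :
  G \is a GRing.unit -> anticomm3 G Y -> G * Y * G^-1 = - Y.
Proof. by move=> Gu GY; rewrite GY mulNr mulrK. Qed.

Definition Ldata_of (G Y : 'M[k]_3) (Gu : G \is a GRing.unit)
    (GY : anticomm3 G Y) : Ldata 'M[k]_3 :=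
  MkLdata (divrr Gu) (mulVr Gu) (Ldata_of_subproof Gu GY).

Notation kx := {a : k | a != 0}.

Definition modV (a : kx) : lmodType (L k) :=
  Lmod3 (Ldata_of (gV_unit (valP a)) (anticomm3V (val a))).
Definition modC (a : kx) : lmodType (L k) :=
  Lmod3 (Ldata_of (gC_unit (valP a)) (anticomm3C (val a))).
Definition modE1 (a : kx) : lmodType (L k) :=
  Lmod3 (Ldata_of (gE_unit (valP a)) (anticomm3E1 (val a))).
Definition modE2 (a : kx) : lmodType (L k) :=
  Lmod3 (Ldata_of (gE_unit (valP a)) (anticomm3E2 (val a))).
Definition modE3 (a b : kx) : lmodType (L k) :=
  Lmod3 (Ldata_of (gE_unit (valP a)) (anticomm3E3 (val a) (val b))).

(* A choice of one of the five families together with its parameters. *)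
Inductive family3 : Type :=
| FamV of kx
| FamC of kx
| FamE1 of kx
| FamE2 of kx
| FamE3 of kx & kx.

Definition family3_mod (p : family3) : lmodType (L k) :=
  match p with
  | FamV a => modV a
  | FamC a => modC a
  | FamE1 a => modE1 a
  | FamE2 a => modE2 a
  | FamE3 a b => modE3 a b
  end.

End Families.

(* V has dimension n over k, where c in k acts on V as c%:A in L. *)
Definition has_kdim (k : fieldType) (V : lmodType (L k)) (n : nat) : Prop :=
  exists e : 'I_n -> V,
    forall v : V, exists! c : 'rV[k]_n, v = \sum_(i < n) (c 0 i)%:A *: e i.

Definition mod_iso (R : nzRingType) (V W : lmodType R) : Prop :=
  exists f : {linear V -> W}, bijective f.

Definition indecomposable (R : nzRingType) (V : lmodType R) : Prop :=
  (exists v : V, v != 0) /\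
  forall A B : {pred V},
    submod_closed A -> submod_closed B ->
    (forall v, v \in A -> v \in B -> v = 0) ->
    (forall v, exists a b, [/\ a \in A, b \in B & v = a + b]) ->
    (forall v, v \in A -> v = 0) \/ (forall v, v \in B -> v = 0).

(* Main.v *)
(* Over k, an L-module of dimension 3 is a pair of 3x3 matrices (G, Y) with G
   invertible and G Y = - Y G, up to simultaneous conjugation, and on an
   indecomposable one every idempotent matrix commuting with G and Y is 0 or 1.
   Since G^2 commutes with G and Y, it has a single eigenvalue a^2. Dividing G
   by a square root of the unipotent matrix G^2 / a^2 gives a polynomial D in G
   with D^2 = a^2 and D Y = - Y D, and G = D (1 + n) with n nilpotent. In an
   eigenbasis of D, up to the sign of a, either D = a and then Y = 0 and G is a
   Jordan block, or D = diag(a, a, -a) and then (G, Y) is given by a nilpotent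
   2x2 block, a row and a column, which an explicit change of
   basis normalizes.
   Conversely, the modules C, V, E1, E3 have the simple socle k e_1 and E2 is
   generated by any vector outside k e_1 + k e_3. The families and their
   parameters are separated by the trace and determinant of G and by which of
   the relations G^2 = c, (G - c) Y = 0, Y^2 = c (G^2 - d) hold. *)
From HB Require Import structures.
Require Import Defs.
From mathcomp Require Import all_boot all_order all_algebra.
From mathcomp Require Import boolp ring.

Set Implicit Arguments.
Unset Strict Implicit.
Unset Printing Implicit Defensive.

Import GRing.Theory.
Local Open Scope ring_scope.

(** * Generators of [L], linear maps over [L] and transport along isomorphisms *)

Lemma L_ind (k : fieldType) (P : L k -> Prop) :
  (forall c : k, P c%:A) -> P (Ly k) -> P (Lg k) -> P (Lgi k) ->
  (forall x z, P x -> P z -> P (x + z)) ->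
  (forall x z, P x -> P z -> P (x * z)) -> forall x, P x.
Proof.
move=> Pc Py Pg Pgi PD PM x; have [s ->] := Lpi_surj x.
elim: s => [c||||s IHs t IHt|s IHs t IHt] //.
- have -> : \pi_(L k)%qT (Cst c) = c%:A; last exact: Pc.
  by rewrite -[LHS]mulr1.
- by rewrite -LaddE; apply: PD.
- by rewrite -LmulE; apply: PM.
Qed.

Lemma LgM_inj (k : fieldType) (V : lmodType (L k)) :
  injective ( *:%R (Lg k) : V -> V).
Proof. by move=> u v /(congr1 ( *:%R (Lgi k))); rewrite !scalerA LVg !scale1r. Qed.

(** Compatibility with [Lgi] follows from that with [Lg], which acts injectively. Induction on a
    formal expression of the scalar then covers all of [L]. *)
Lemma L_linear (k : fieldType) (V W : lmodType (L k)) (f : V -> W) :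
  {morph f : u v / u + v} ->
  (forall (c : k) v, f (c%:A *: v) = c%:A *: f v) ->
  (forall v, f (Ly k *: v) = Ly k *: f v) ->
  (forall v, f (Lg k *: v) = Lg k *: f v) -> linear f.
Proof.
move=> fD fc fy fg.
have fgi v : f (Lgi k *: v) = Lgi k *: f v.
  by apply: LgM_inj; rewrite -fg !scalerA LgV !scale1r.
suff fZ x : forall v, f (x *: v) = x *: f v by move=> x u v; rewrite fD fZ.
elim/L_ind: x => // [x z IHx IHz|x z IHx IHz] v.
- by rewrite !scalerDl fD IHx IHz.
- by rewrite -!scalerA IHx IHz.
Qed.

Lemma linear_bij_iso (R : nzRingType) (V W : lmodType R) (f : V -> W) :
  linear f -> bijective f -> mod_iso V W.
Proof.
move=> lf bf.
pose f' : {linear V -> W} := HB.pack f (GRing.isLinear.Build R V W *:%R f lf).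
by exists f'.
Qed.

Lemma mod_iso_sym (R : nzRingType) (V W : lmodType R) :
  mod_iso V W -> mod_iso W V.
Proof.
case=> f [h fK hK]; apply: (@linear_bij_iso _ _ _ h); last by exists f.
by move=> x u v; apply: (can_inj fK); rewrite linearP !hK.
Qed.

Lemma mod_iso_trans (R : nzRingType) (U V W : lmodType R) :
  mod_iso U V -> mod_iso V W -> mod_iso U W.
Proof.
case=> f bf [h bh]; apply: (@linear_bij_iso _ _ _ (h \o f)).
  by move=> x u v; rewrite /= !linearP.
exact: bij_comp.
Qed.

Lemma indecomposable_iso (R : nzRingType) (V W : lmodType R) :
  mod_iso V W -> indecomposable V -> indecomposable W.
Proof.
case=> f [h fK hK] [[v0 v0n] indV]; split.
  by exists (f v0); apply: contra_neq v0n => f0;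
    rewrite -(fK v0) f0 -(fK 0) linear0.
move=> A B sA sB AB0 AB.
(* A decomposition of [W] is pulled back along [f] to one of [V]. *)
have sub (C : {pred W}) : submod_closed C -> submod_closed [pred v | f v \in C].
  case=> C0 CP; split=> [|x u v]; rewrite !inE ?linear0 // => uC vC.
  by rewrite linearP; apply: CP.
have := indV _ _ (sub A sA) (sub B sB).
case=> [v vA vB|v|A0|B0].
- by rewrite -(fK v) (AB0 (f v)) // -(linear0 f) fK.
- have [a [b [aA bB vE]]] := AB (f v); exists (h a), (h b).
  rewrite !inE !hK; split=> //.
  by apply: (can_inj fK); rewrite linearD !hK.
- by left=> w wA; have := A0 (h w);
  rewrite inE hK => /(_ wA)/(congr1 f); rewrite hK linear0.
- by right=> w wB; have := B0 (h w);
  rewrite inE hK => /(_ wB)/(congr1 f); rewrite hK linear0.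
Qed.

(** * Three-dimensional modules as pairs of matrices up to conjugation *)

Section MatrixModules.
Variable k : fieldType.
Implicit Types (d : Ldata 'M[k]_3) (P Q G Y : 'M[k]_3).

Lemma matrix_ext (M N : 'M[k]_3) : (forall v : 'cV_3, M *m v = N *m v) -> M = N.
Proof.
move=> MN; apply/matrixP=> i j; have := MN (delta_mx j 0).
by rewrite -!colE => /colP/(_ i); rewrite !mxE.
Qed.

Lemma scaleLmod3 d (x : L k) (v : Lmod3 d) :
  x *: v = Llift d x *m (v : 'cV_3) :> 'cV_3.
Proof. by []. Qed.

Lemma Llift_cst d (c : k) : Llift d c%:A = c%:M.
Proof. by rewrite linearZ /= rmorph1 -scalemx1. Qed.

Lemma cstLmod3 d (c : k) (v : Lmod3 d) : c%:A *: v = c *: (v : 'cV_3) :> 'cV_3.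
Proof. by rewrite scaleLmod3 Llift_cst mul_scalar_mx. Qed.

Lemma yLmod3 d (v : Lmod3 d) : Ly k *: v = Ld_y d *m (v : 'cV_3) :> 'cV_3.
Proof. by rewrite scaleLmod3 Llift_y. Qed.

Lemma gLmod3 d (v : Lmod3 d) : Lg k *: v = Ld_g d *m (v : 'cV_3) :> 'cV_3.
Proof. by rewrite scaleLmod3 Llift_g. Qed.

(** [P] is the matrix of a map from the module of [(G', Y')] to that of [(G, Y)]. This direction is
    why [mod_iso_sym] appears in the two lemmas relating similarity to isomorphism. *)
Definition similar_pair (G Y G' Y' : 'M[k]_3) :=
  exists2 P, P \is a GRing.unit & G * P = P * G' /\ Y * P = P * Y'.

Lemma similar_pair_iso d d' :
  similar_pair (Ld_g d) (Ld_y d) (Ld_g d') (Ld_y d') ->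
  mod_iso (Lmod3 d) (Lmod3 d').
Proof.
case=> P Pu [gP yP]; apply: mod_iso_sym.
apply: (@linear_bij_iso _ (Lmod3 d') (Lmod3 d) (fun v => P *m v)).
  apply: L_linear => [u v|c v|v|v].
  - exact: mulmxDr.
  - by rewrite !cstLmod3 scalemxAr.
  - rewrite !yLmod3 !mulmxA; congr (_ *m _); exact/esym.
  - rewrite !gLmod3 !mulmxA; congr (_ *m _); exact/esym.
exists (fun v => P^-1 *m v) => v.
  by rewrite mulmxA (mulVr Pu : P^-1 *m P = 1%:M) mul1mx.
by rewrite mulmxA (divrr Pu : P *m P^-1 = 1%:M) mul1mx.
Qed.

Lemma iso_similar_pair d d' :
  mod_iso (Lmod3 d) (Lmod3 d') ->
  similar_pair (Ld_g d) (Ld_y d) (Ld_g d') (Ld_y d').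
Proof.
move=> /mod_iso_sym [f [h fK hK]].
(* The scalars [c%:A] act as [c], so a map linear over [L] is linear over [k] and has a matrix. *)
have lin (d1 d2 : Ldata 'M[k]_3) (f1 : Lmod3 d1 -> Lmod3 d2) : linear f1 ->
    exists P, forall v : 'cV_3, f1 v = P *m v.
  move=> lf.
  have lf' : linear (f1 : 'cV[k]_3 -> 'cV[k]_3).
    move=> c u v; have := lf c%:A u v.
    have -> : c%:A *: (u : Lmod3 d1) + v = c *: u + v by rewrite cstLmod3.
    by move=> ->; rewrite cstLmod3.
  pose f2 : {linear 'cV[k]_3 -> 'cV[k]_3} :=
    HB.pack (f1 : 'cV[k]_3 -> 'cV[k]_3)
      (GRing.isLinear.Build k _ _ *:%R
        (f1 : 'cV[k]_3 -> 'cV[k]_3) lf').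
  exists (\matrix_(i, j) (f2 (delta_mx j 0)) i 0) => v.
  rewrite -[f1 v]/(f2 v) {1}(matrix_sum_delta v) linear_sum.
  apply/colP=> i; rewrite !mxE summxE; apply: eq_bigr => j _.
  by rewrite big_ord1 linearZ !mxE mulrC.
have [P fP] := lin _ _ f (linearP f).
have lh : linear h by move=> x u v; apply: (can_inj fK); rewrite linearP !hK.
have [Q hQ] := lin _ _ h lh.
have QP : Q * P = 1 by apply: matrix_ext => v; rewrite mul1mx -mulmxA -fP -hQ fK.
have PQ : P * Q = 1 by apply: matrix_ext => v; rewrite mul1mx -mulmxA -hQ -fP hK.
exists P; first by apply/unitrP; exists Q.
split; apply: matrix_ext => v; rewrite -!mulmxA -!fP.
  by rewrite -gLmod3 -linearZ gLmod3.
by rewrite -yLmod3 -linearZ yLmod3.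
Qed.

(** Coordinates in a basis identify [V] with [k^3]. The matrices by which the generators act in
    these coordinates satisfy the defining relations. *)
Lemma has_kdim_Lmod3 (V : lmodType (L k)) : has_kdim V 3 ->
  exists d, mod_iso V (Lmod3 d).
Proof.
case=> e He.
have {}He v : exists c : 'cV[k]_3, v = \sum_i (c i 0)%:A *: e i /\
    forall c' : 'cV[k]_3, v = \sum_i (c' i 0)%:A *: e i -> c = c'.
  have [r [vr ur]] := He v; exists r^T; split=> [|r' vr'].
    by rewrite {1}vr; apply: eq_bigr => i _; rewrite mxE.
  rewrite (ur r'^T) ?trmxK // {1}vr'; apply: eq_bigr => i _; by rewrite mxE.
have [c cP] := choice He.
pose comb (r : 'cV[k]_3) : V := \sum_i (r i 0)%:A *: e i.
have cK v : comb (c v) = v.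
  by have [vE _] := cP v; rewrite /comb -vE.
have combK r : c (comb r) = r.
  have [_ u] := cP (comb r); exact: u.
have combD r s : comb (r + s) = comb r + comb s.
  rewrite /comb -big_split; apply: eq_bigr => i _ /=.
  by rewrite mxE scalerDl scalerDl.
have combZ a r : comb (a *: r) = a%:A *: comb r.
  rewrite /comb scaler_sumr; apply: eq_bigr => i _.
  by rewrite mxE scalerA -scalerAl mul1r scalerA.
have cD u v : c (u + v) = c u + c v.
  by rewrite -{1}(cK u) -{1}(cK v) -combD combK.
have cZ a v : c (a%:A *: v) = a *: c v by rewrite -{1}(cK v) -combZ combK.
(* Column [j] of [M x] holds the coordinates of [x *: e j], so [M] is the matrix representation of
   [L] on [V]. *)
pose M x : 'M[k]_3 := \matrix_(i, j) c (x *: e j) i 0.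
have cM x v : c (x *: v) = M x *m c v.
  have c0 : c 0 = 0 by rewrite -(scale0r 0) -(scale0r 1) cZ scale0r.
  rewrite -{1}(cK v) /comb scaler_sumr (big_morph c cD c0).
  apply/colP=> i; rewrite summxE !mxE; apply: eq_bigr => j _.
  have -> : x *: ((c v j 0)%:A *: e j) = (c v j 0)%:A *: (x *: e j).
    by rewrite !scalerA -scalerAr -scalerAl mul1r mulr1.
  by rewrite cZ !mxE mulrC.
have ext (A B : 'M[k]_3) : (forall v : V, A *m c v = B *m c v) -> A = B.
  by move=> AB; apply: matrix_ext => r; rewrite -(combK r).
have MM x z : M x * M z = M (x * z).
  by apply: ext => v; rewrite -[_ *m _]mulmxA -!cM scalerA.
have M1 : M 1 = 1 by apply: ext => v; rewrite -cM scale1r mul1mx.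
have MN x : M (- x) = - M x.
  by apply: ext => v; rewrite -cM mulNmx -cM scaleNr;
  rewrite -scaleN1r -(scaleN1r 1) cZ scaleN1r.
have gV : M (Lg k) * M (Lgi k) = 1 by rewrite MM LgV.
have Vg : M (Lgi k) * M (Lg k) = 1 by rewrite MM LVg.
have gyV : M (Lg k) * M (Ly k) * M (Lgi k) = - M (Ly k) by rewrite !MM LgyV MN.
exists (MkLdata gV Vg gyV).
apply: (@linear_bij_iso _ V (Lmod3 _) c); last by exists comb.
by apply: L_linear => // [a v|v|v]; rewrite ?cZ ?cstLmod3 ?yLmod3 ?gLmod3 ?cM.
Qed.
End MatrixModules.

(** * Idempotents commuting with an indecomposable pair *)

Section IndecomposablePair.
Variable k : fieldType.
Implicit Types (d : Ldata 'M[k]_3) (E P Q G S Y : 'M[k]_3).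

Definition indecomposable_pair G Y :=
  forall E, E * E = E -> E * G = G * E -> E * Y = Y * E -> E = 0 \/ E = 1.

(** An idempotent commuting with [g] and [y] commutes with the whole action, also with [g^-1] by
    multiplying on both sides. Its fixed space [A] and its kernel [B] are then complementary
    submodules. *)
Lemma indecomposable_Lmod3_pair d :
  indecomposable (Lmod3 d) -> indecomposable_pair (Ld_g d) (Ld_y d).
Proof.
case=> _ indd E EE Eg Ey.
have Ex x : E * Llift d x = Llift d x * E.
  elim/L_ind: x => [c||||x z Ex Ez|x z Ex Ez].
  - by rewrite Llift_cst; apply: scalar_mxC.
  - by rewrite Llift_y.
  - by rewrite Llift_g.
  - rewrite Llift_gi -[LHS]mul1r -(Ld_Vg d) -[RHS]mulr1 -(Ld_gV d).
    by rewrite -!mulrA (mulrA _ E) -Eg !mulrA.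
  - by rewrite rmorphD mulrDr mulrDl Ex Ez.
  - by rewrite !rmorphM mulrA Ex -!mulrA Ez.
pose A : {pred Lmod3 d} := [pred v | E *m v == v].
pose B : {pred Lmod3 d} := [pred v | E *m v == 0].
have sA : submod_closed A.
  split=> [|x u v]; rewrite !inE ?mulmx0 // => /eqP uA /eqP vA; apply/eqP.
  by rewrite mulmxDr vA scaleLmod3 mulmxA (Ex x : _ *m _ = _ *m _) -mulmxA uA.
have sB : submod_closed B.
  split=> [|x u v]; rewrite !inE ?mulmx0 // => /eqP uA /eqP vA; apply/eqP.
  by rewrite mulmxDr vA scaleLmod3 mulmxA (Ex x : _ *m _ = _ *m _) -mulmxA uA
    mulmx0 addr0.
have [v|v|A0|B0] := indd A B sA sB.
- by rewrite !inE => /eqP vA /eqP; rewrite vA.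
- exists (E *m v), (v - E *m v); rewrite !inE [E *m v + _]addrC subrK mulmxBr !mulmxA.
  by rewrite (EE : E *m E = E) subrr !eqxx.
- left; apply: matrix_ext => v; rewrite mul0mx; apply: A0.
  by rewrite inE mulmxA (EE : E *m E = E).
- right; apply: matrix_ext => v; rewrite mul1mx; apply/esym/eqP; rewrite -subr_eq0.
  by apply/eqP/B0; rewrite inE mulmxBr mulmxA (EE : E *m E = E) subrr.
Qed.

Lemma similar_pair_trans G Y G' Y' G2 Y2 :
  similar_pair G Y G' Y' -> similar_pair G' Y' G2 Y2 -> similar_pair G Y G2 Y2.
Proof.
case=> P Pu [gP yP] [Q Qu [gQ yQ]]; exists (P * Q); first by rewrite unitrMl.
by rewrite !mulrA gP yP -!mulrA gQ yQ.
Qed.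

Lemma indecomposable_similar G Y G' Y' :
  similar_pair G Y G' Y' -> indecomposable_pair G Y -> indecomposable_pair G' Y'.
Proof.
case=> P Pu [gP yP] ind E EE Eg Ey.
have comm M M' : M * P = P * M' -> E * M' = M' * E ->
    P * E * P^-1 * M = M * (P * E * P^-1).
  move=> MP EM; have -> : M = P * M' * P^-1 by rewrite -MP mulrK.
  by rewrite !mulrA !(mulrVK Pu) -(mulrA P) EM mulrA.
have [||||] := ind (P * E * P^-1).
- by rewrite !mulrA (mulrVK Pu) -[P * E * E]mulrA EE.
- exact: comm gP Eg.
- exact: comm yP Ey.
- move/(congr1 (fun M => P^-1 * M * P)); rewrite mulr0 mul0r !mulrA mulVr // mul1r.
  by rewrite mulrVK //; left.
- move/(congr1 (fun M => P^-1 * M * P)); rewrite mulr1 !mulrA mulVr // mul1r.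
  by rewrite mulrVK //; right.
Qed.

(** For a Bezout relation [u p + v q = 1], the matrices [(u p)(S)] and [(v q)(S)] have sum 1 and
    product 0. So [(u p)(S)] is an idempotent commuting with [G] and [Y]. If it is 0 then
    [p(S) = 0], and if it is 1 then [q(S) = 0]. *)
Lemma indecomposable_coprime G Y S (p q : {poly k}) :
  indecomposable_pair G Y -> S * G = G * S -> S * Y = Y * S ->
  coprimep p q -> horner_mx S (p * q) = 0 ->
  horner_mx S p = 0 \/ horner_mx S q = 0.
Proof.
move=> ind SG SY /Bezout_eq1_coprimepP [[u v] /= uv] pq0.
have comm M r : S * M = M * S -> horner_mx S r * M = M * horner_mx S r.
  by move=> SM; apply/esym/comm_mx_horner; exact: esym.
have up : horner_mx S (u * p) * horner_mx S (v * q) = 0.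
  by rewrite -rmorphM mulrACA rmorphM /= pq0 mulr0.
have sum1 : horner_mx S (u * p) + horner_mx S (v * q) = 1.
  by rewrite -rmorphD uv rmorph1.
case: (ind (horner_mx S (u * p))); rewrite ?comm //.
- by rewrite -[RHS]mulr1 -[in RHS]sum1 mulrDr up addr0.
- move=> up0; left; rewrite -[LHS]mul1r -sum1 up0 add0r -rmorphM.
  by rewrite mulrAC -mulrA rmorphM /= pq0 mulr0.
- move=> up1; right; rewrite -[LHS]mul1r -up1 -rmorphM.
  by rewrite -mulrA rmorphM /= pq0 mulr0.
Qed.

End IndecomposablePair.

(** The minimal polynomial of [S] has a root [r] and factors as [q (X - r)^m] with [q(r) != 0].
    These factors are coprime, so one of them vanishes at [S]. It cannot be [q], whose degree is too
    small. *)
Lemma indecomposable_nilpotent (k : closedFieldType) (G Y S : 'M[k]_3) :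
  indecomposable_pair G Y -> S * G = G * S -> S * Y = Y * S ->
  exists r, (S - r%:M) ^+ 3 = 0.
Proof.
move=> ind SG SY; pose p := mxminpoly S.
have pm : p \is monic := mxminpoly_monic S.
have [r rp] : exists r, root p r.
  apply/closed_rootP; rewrite size_mxminpoly eqSS.
  by rewrite -lt0n mxminpoly_nonconstant.
exists r; have [m [q]] := multiplicity_XsubC p r.
rewrite monic_neq0 //= => nqr pE.
have m0 : (0 < m)%N.
  by case: m pE => // pE; move: rp nqr; rewrite pE expr0 mulr1 => ->.
have hX : horner_mx S (('X - r%:P) ^+ m) = (S - r%:M) ^+ m.
  by rewrite rmorphXn rmorphB /= horner_mx_X horner_mx_C.
have q0 : q != 0 by apply: contraNneq nqr => ->; rewrite root0.
have sp : size p = (size q + m)%N.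
  by rewrite pE size_Mmonic ?monic_exp ?monicXsubC // size_exp_XsubC addnS.
have cop : coprimep q (('X - r%:P) ^+ m).
  by rewrite coprimep_expr // coprimep_XsubC.
have := indecomposable_coprime ind SG SY cop.
rewrite -pE mx_root_minpoly => /(_ erefl) [qS|].
  have /dvdp_leq := mxminpoly_min qS; move/(_ q0).
  by rewrite -/p sp -{2}[size q]addn0 leq_add2l leqn0 -[_ == _]negbK -lt0n m0.
rewrite hX => Sm.
(* The minimal polynomial divides the characteristic polynomial, whose size is 4. *)
have m3 : (m <= 3)%N.
  have := mxminpoly_dvd_char S; move/dvdp_leq.
  rewrite monic_neq0 ?char_poly_monic // size_char_poly -/p sp => /(_ isT) le.
  have : (1 + m <= 4)%N by apply: leq_trans le; rewrite leq_add2r lt0n size_poly_eq0.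
  by rewrite add1n ltnS.
by have := mulr0 ((S - r%:M) ^+ (3 - m)); rewrite -{1}Sm -exprD subnK.
Qed.

(** [D] is [G] times a truncated power series in [G ^+ 2 - a ^+ 2], whose cube is 0. Being [G] times
    a polynomial in [G ^+ 2], it commutes with [G] and anticommutes with [Y]. *)
Lemma anticomm_grading (k : closedFieldType) (hk : [pchar k] =i pred0)
    (G Y : 'M[k]_3) :
  G \is a GRing.unit -> G * Y = - (Y * G) -> indecomposable_pair G Y ->
  exists2 a, a != 0 & exists D,
    [/\ D * D = (a ^+ 2)%:M, D * G = G * D, D * Y = - (Y * D)
      & (D * G - (a ^+ 2)%:M) ^+ 3 = 0].
Proof.
move=> Gu GY ind.
have SY : G ^+ 2 * Y = Y * G ^+ 2.
  by rewrite expr2 -mulrA GY mulrN [G * (Y * G)]mulrA GY mulNr opprK mulrA.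
have SG : G ^+ 2 * G = G * G ^+ 2 by rewrite -exprS -exprSr.
have [r Sr] := indecomposable_nilpotent ind SG SY.
have [a ra] : exists a, r = a ^+ 2.
  have [|a] := @closed_rootP k ('X^2 - r%:P) _.
    by rewrite size_XnsubC.
  by rewrite /root !hornerE subr_eq0 => /eqP <-; exists a.
(* With [a = 0] the invertible matrix [G ^+ 6] would be 0. *)
have a0 : a != 0.
  apply: contraTneq (unitrX 6 Gu) => a0; rewrite -[6%N]/(2 * 3)%N exprM.
  by move: Sr; rewrite ra a0 expr0n /= raddf0 subr0 => ->; rewrite unitr0.
(* W / (8 a^4) is the expansion of (1 + T / A)^(-1/2) up to order T^2. *)
pose A : {poly k} := (a ^+ 2)%:P; pose T : {poly k} := 'X ^+ 2 - A.
pose W : {poly k} := 8 * A ^+ 2 - 4 * A * T + 3 * T ^+ 2.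
have T3 : horner_mx G (T ^+ 3) = 0.
  by rewrite rmorphXn rmorphB /= rmorphXn /= horner_mx_X horner_mx_C -ra.
have T3M p : horner_mx G (T ^+ 3 * p) = 0 by rewrite rmorphM /= T3 mul0r.
have TY : horner_mx G T * Y = Y * horner_mx G T.
  rewrite rmorphB /= rmorphXn /= horner_mx_X horner_mx_C mulrBl mulrBr SY.
  by congr (_ - _); apply/esym/scalar_mxC.
pose commY p := horner_mx G p * Y = Y * horner_mx G p.
have commD p q : commY p -> commY q -> commY (p + q).
  by rewrite /commY rmorphD mulrDl mulrDr => -> ->.
have commM p q : commY p -> commY q -> commY (p * q).
  by rewrite /commY rmorphM => pY qY; rewrite -mulrA qY mulrA pY mulrA.
have commC b : commY b%:P.
  by rewrite /commY horner_mx_C; apply/esym/scalar_mxC.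
have WY : commY W.
  have -> : W = (8 * a ^+ 4)%:P + (- 4 * a ^+ 2)%:P * T + 3%:P * (T * T).
    by rewrite /W /A; ring.
  apply: (commD); first by apply: (commD) => //; apply: (commM).
  by apply: (commM) => //; apply: (commM).
have GX : horner_mx G 'X = G by exact: horner_mx_X.
pose c := (8 * a ^+ 4)^-1.
have n8 : 8 != 0 :> k by move/pcharf0P: hk => ->.
have hl M : c *: horner_mx G ('X * W) * M = c *: (horner_mx G ('X * W) * M).
  exact/esym/scalemxAl.
have hr M : M * (c *: horner_mx G ('X * W)) = c *: (M * horner_mx G ('X * W)).
  exact/esym/scalemxAr.
exists a => //; exists (c *: horner_mx G ('X * W)); split.
- rewrite hl hr scalerA -rmorphM.
  (* Since [X ^ 2 = A + T], the terms in [T] and [T ^ 2] cancel. The constant left is the square of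
     [8 a ^ 4] times [a ^ 2]. *)
  have -> : 'X * W * ('X * W) = (64 * a ^+ 10)%:P +
      T ^+ 3 * (40 * A ^+ 2 - 15 * A * T + 9 * T ^+ 2).
    by rewrite /W /T /A; ring.
  rewrite rmorphD /= T3M addr0 horner_mx_C scale_scalar_mx.
  by rewrite /c; congr _%:M; field; rewrite a0 n8.
- by rewrite hl hr -{2 3}GX -!rmorphM mulrC.
- by rewrite hl hr -scalerN rmorphM /= GX -mulrA WY mulrA GY mulNr !mulrA.
- rewrite hl -{2}GX -rmorphM.
  (* Here [D * G - a ^ 2] turns out to be a multiple of [T] evaluated at [G], so its cube
     vanishes. *)
  have -> : 'X * W * 'X = (8 * a ^+ 6)%:P + T * (4 * A ^+ 2 - A * T + 3 * T ^+ 2).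
    by rewrite /W /T /A; ring.
  rewrite rmorphD /= horner_mx_C scalerDr scale_scalar_mx.
  have -> : c * (8 * a ^+ 6) = a ^+ 2 by rewrite /c; field; rewrite a0 n8.
  rewrite addrAC subrr add0r exprZn -(rmorphXn (horner_mx G)) exprMn.
  by apply: etrans (scaler0 _ (c ^+ 3)); congr (_ *: _); exact: T3M.
Qed.

(** * Matrices with explicit entries *)

Section Mat3.
Variable k : fieldType.

Definition mat3 (a b c d e f g h i : k) : 'M[k]_3 :=
  \matrix_(r, s) nth 0 (nth [::] [:: [:: a; b; c]; [:: d; e; f]; [:: g; h; i]] r) s.

Lemma mat3_eta (M : 'M[k]_3) :
  M = mat3 (M 0 0) (M 0 1) (M 0 2) (M 1 0) (M 1 1) (M 1 2) (M 2 0) (M 2 1) (M 2 2).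
Proof. by apply/matrixP=> i j; rewrite mxE; case: (ord3P i); case: (ord3P j). Qed.

Lemma mat3_inj a b c d e f g h i a' b' c' d' e' f' g' h' i' :
  mat3 a b c d e f g h i = mat3 a' b' c' d' e' f' g' h' i' ->
  [/\ [/\ a = a', b = b' & c = c'], [/\ d = d', e = e' & f = f']
    & [/\ g = g', h = h' & i = i']].
Proof.
move=> /matrixP E;
have := (E 0 0, E 0 1, E 0 2, E 1 0, E 1 1, E 1 2, E 2 0, E 2 1, E 2 2).
by rewrite !mxE /= => -[[[[[[[[]]]]]]]].
Qed.

Lemma mat3_mul a b c d e f g h i a' b' c' d' e' f' g' h' i' :
  mat3 a b c d e f g h i * mat3 a' b' c' d' e' f' g' h' i' =
  mat3 (a * a' + b * d' + c * g') (a * b' + b * e' + c * h') (a * c' + b * f' + c * i')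
       (d * a' + e * d' + f * g') (d * b' + e * e' + f * h') (d * c' + e * f' + f * i')
       (g * a' + h * d' + i * g') (g * b' + h * e' + i * h') (g * c' + h * f' + i * i').
Proof.
apply/matrixP=> r s; rewrite !mxE 2!big_ord_recl big_ord1 !mxE /=.
by case: (ord3P r); case: (ord3P s); rewrite /= addrA.
Qed.

Lemma mat3_add a b c d e f g h i a' b' c' d' e' f' g' h' i' :
  mat3 a b c d e f g h i + mat3 a' b' c' d' e' f' g' h' i' =
  mat3 (a + a') (b + b') (c + c') (d + d') (e + e') (f + f') (g + g') (h + h') (i + i').
Proof. by apply/matrixP=> r s; rewrite !mxE; case: (ord3P r); case: (ord3P s). Qed.

Lemma mat3_opp a b c d e f g h i :
  - mat3 a b c d e f g h i =
  mat3 (- a) (- b) (- c) (- d) (- e) (- f) (- g) (- h) (- i).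
Proof. by apply/matrixP=> r s; rewrite !mxE; case: (ord3P r); case: (ord3P s). Qed.

Lemma mat3_scalar a : a%:M = mat3 a 0 0 0 a 0 0 0 a.
Proof. by apply/matrixP=> r s; rewrite !mxE; case: (ord3P r); case: (ord3P s). Qed.

Lemma mat3_0 : 0 = mat3 0 0 0 0 0 0 0 0 0.
Proof. by rewrite -mat3_scalar raddf0. Qed.

Lemma mat3_1 : 1 = mat3 1 0 0 0 1 0 0 0 1.
Proof. by rewrite -mat3_scalar. Qed.

Lemma mat3_unit a b c d e f g h i :
  a * (e * i - f * h) - b * (d * i - f * g) + c * (d * h - e * g) != 0 ->
  mat3 a b c d e f g h i \is a GRing.unit.
Proof.
set D := (X in X != 0) => D0.
(* [M] is the adjugate matrix and [D] the determinant. *)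
pose M := mat3 (e * i - f * h) (c * h - b * i) (b * f - c * e)
               (f * g - d * i) (a * i - c * g) (c * d - a * f)
               (d * h - e * g) (b * g - a * h) (a * e - b * d).
suff E : mat3 a b c d e f g h i * M = D%:M.
  have /mulmx1_unit[] // : mat3 a b c d e f g h i *m (M * (D^-1)%:M) = 1%:M.
  by rewrite mulmxA (E : _ *m _ = _) -scalar_mxM divff.
by rewrite mat3_mul mat3_scalar; congr mat3; rewrite /D; ring.
Qed.

Lemma gVE a : gV a = mat3 a 1 0 0 a 1 0 0 a.
Proof. by apply/matrixP=> r s; rewrite !mxE; case: (ord3P r); case: (ord3P s);
  rewrite /= !mxE /= ?mulr0 ?mulr1 ?addr0 ?add0r. Qed.
Lemma gCE a : gC a = mat3 a 0 0 0 a 0 0 0 (- a).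
Proof. by apply/matrixP=> r s; rewrite !mxE; case: (ord3P r); case: (ord3P s);
  rewrite /= !mxE /= ?mulr0 ?mulr1 ?addr0 ?add0r. Qed.
Lemma gEE a : gE a = mat3 a 1 0 0 a 0 0 0 (- a).
Proof. by apply/matrixP=> r s; rewrite !mxE; case: (ord3P r); case: (ord3P s);
  rewrite /= !mxE /= ?mulr0 ?mulr1 ?addr0 ?add0r. Qed.
Lemma yVE : yV k = 0.
Proof. by apply/matrixP=> r s; rewrite !mxE; case: (ord3P s);
  rewrite /= !mxE. Qed.
Lemma yCE : yC k = mat3 0 0 1 0 0 0 0 1 0.
Proof. by apply/matrixP=> r s; rewrite !mxE; case: (ord3P r); case: (ord3P s);
  rewrite /= !mxE. Qed.
Lemma yE1E : yE1 k = mat3 0 0 1 0 0 0 0 0 0.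
Proof. by apply/matrixP=> r s; rewrite !mxE; case: (ord3P r); case: (ord3P s);
  rewrite /= !mxE. Qed.
Lemma yE2E : yE2 k = mat3 0 0 0 0 0 0 0 1 0.
Proof. by apply/matrixP=> r s; rewrite !mxE; case: (ord3P r); case: (ord3P s);
  rewrite /= !mxE. Qed.
Lemma yE3E b : yE3 b = mat3 0 0 b 0 0 0 0 1 0.
Proof. by apply/matrixP=> r s; rewrite !mxE; case: (ord3P r); case: (ord3P s);
  rewrite /= !mxE /= ?mulr0 ?mulr1. Qed.
End Mat3.

(** * Block form of a pair in an eigenbasis of [D] *)

Section NormalForm.
Variable k : fieldType.

(** [D] is annihilated by [(X - a)(X + a)], which has distinct roots as [2 != 0], so it is
    diagonalizable with eigenvalues [a] and [- a]. Two of the three eigenvalues agree; a permutation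
    puts them first, [b] being the repeated one. *)
Lemma sign_diagonalization (a : k) (D : 'M[k]_3) : a != 0 -> 2 != 0 :> k ->
  D * D = (a ^+ 2)%:M ->
  exists b c, [/\ b ^+ 2 = a ^+ 2, c = b \/ c = - b &
    exists2 P, P \is a GRing.unit & D * P = P * mat3 b 0 0 0 b 0 0 0 c].
Proof.
move=> a0 n2 DD.
have aN : a != - a by rewrite -subr_eq0 opprK -mulr2n -mulr_natl mulf_neq0.
have : diagonalizable D.
  apply/diagonalizableP; exists [:: a; - a].
    by rewrite /= inE aN.
  apply: mxminpoly_min; rewrite !big_cons big_nil mulr1.
  rewrite rmorphM !rmorphB /= horner_mx_X !horner_mx_C raddfN opprK.
  rewrite mulrDr mulrBl DD mulrBl (scalar_mxC a D : _ * _ = _ * _) addrA subrK.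
  by rewrite -[X in _ - X]scalar_mxM subrr.
case=> P0 P0u /diagonalizable_forPex[s] /(simmxP P0u) E.
have Ps : D * P0^-1 = P0^-1 * diag_mx s.
  apply: (mulrI P0u); rewrite mulVKr // mulrA (E : P0 * D = diag_mx s * P0).
  by rewrite mulrK.
have diagE : diag_mx s = mat3 (s 0 0) 0 0 0 (s 0 1) 0 0 0 (s 0 2).
  by apply/matrixP=> i j; rewrite !mxE; case: (ord3P i); case: (ord3P j).
have s2 i : s 0 i = a \/ s 0 i = - a.
  apply/pred2P; rewrite -eqf_sqr; apply/eqP.
  have : diag_mx s * diag_mx s = (a ^+ 2)%:M.
    have PVu : P0^-1 \is a GRing.unit by rewrite unitrV.
    apply: (mulrI PVu); rewrite mulrA -Ps -mulrA -Ps mulrA DD.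
    exact/esym/scalar_mxC.
  rewrite diagE mat3_mul mat3_scalar !(mul0r, mulr0, addr0, add0r) -!expr2.
  by case/mat3_inj=> -[s0 _ _] [_ s1 _] [_ _ s2]; case: (ord3P i).
(* It remains to reorder the diagonal by a permutation matrix [Q]. *)
have perm Q x y z : Q \is a GRing.unit -> diag_mx s * Q = Q * mat3 x 0 0 0 y 0 0 0 z ->
    exists2 P, P \is a GRing.unit & D * P = P * mat3 x 0 0 0 y 0 0 0 z.
  move=> Qu sQ; exists (P0^-1 * Q); first by rewrite unitrMl // unitrV.
  by rewrite mulrA Ps -(mulrA _ (diag_mx s)) sQ mulrA.
have sq i : s 0 i ^+ 2 = a ^+ 2 by case: (s2 i) => ->; rewrite ?sqrrN.
have opp i j : s 0 i != s 0 j -> s 0 j = - s 0 i.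
  by case: (s2 i) => ->; case: (s2 j) => ->; rewrite ?eqxx ?opprK.
have [s01|/opp s01] := eqVneq (s 0 0) (s 0 1).
  exists (s 0 0), (s 0 2); split => //.
    by have [<-|/opp ->] := eqVneq (s 0 0) (s 0 2); [left|right].
  by apply: (perm 1); rewrite ?unitr1 // mulr1 mul1r diagE s01.
have [s02|/opp s02] := eqVneq (s 0 0) (s 0 2).
  exists (s 0 0), (s 0 1); split => //; first by right.
  apply: (perm (mat3 1 0 0 0 0 1 0 1 0)).
    by apply: mat3_unit; rewrite [X in X != 0](_ : _ = -1) ?oppr_eq0 ?oner_eq0 //; ring.
  by rewrite diagE !mat3_mul s02; congr mat3; ring.
exists (s 0 1), (s 0 0); split => //; first by right; rewrite s01 opprK.
apply: (perm (mat3 0 0 1 0 1 0 1 0 0)).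
  by apply: mat3_unit; rewrite [X in X != 0](_ : _ = -1) ?oppr_eq0 ?oner_eq0 //; ring.
by rewrite diagE !mat3_mul s02 s01; congr mat3; ring.
Qed.

(** The cube of the determinant of the 2x2 block is the determinant of its cube, hence 0. The trace
    vanishes by the identity [tr N ^ 3 = tr (N ^ 3) + 3 tr N det N]. *)
Lemma mat3_cube0 (p q r s t : k) : mat3 p q 0 r s 0 0 0 t ^+ 3 = 0 ->
  [/\ p + s = 0, p * s - q * r = 0 & t = 0].
Proof.
rewrite !exprS expr0 mulr1 !mat3_mul mat3_0.
case/mat3_inj=> -[m00 m01 _] [m10 m11 _] [_ _ m22].
have cube0 (x y : k) : x = y ^+ 3 -> x = 0 -> y = 0.
  by move=> -> /eqP; rewrite expf_eq0 => /eqP.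
have det0 : p * s - q * r = 0.
  have det x y z w : x = 0 -> y = 0 -> z = 0 -> w = 0 -> x * w - y * z = 0 :> k.
    by move=> -> -> -> ->; rewrite !mulr0 subr0.
  by apply: (cube0 _ _ _ (det _ _ _ _ m00 m01 m10 m11)); ring.
split=> //.
- have tr x y : x = 0 -> y = 0 -> x + y + 3 * (p + s) * (p * s - q * r) = 0.
    by move=> -> ->; rewrite det0 mulr0 !addr0.
  by apply: (cube0 _ _ _ (tr _ _ m00 m11)); ring.
- by apply: (cube0 _ _ _ m22); ring.
Qed.

(** If [D] is the scalar [b], anticommutation forces [Y = 0] and [D G - b ^ 2 = b (G - b)]. If
    [D = diag(b, b, -b)], then [G] is block diagonal and [Y] is block antidiagonal. Nilpotency gives
    [G] the blocks [b + N] and [- b], where [N] has rows [(p, q)] and [(r, - p)]. The five equations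
    say [N ^ 2 = 0], [f N = 0] and [N w = 0] for the row [f] and the column [w] of [Y]. *)
Lemma grading_normal_form (a : k) (D G Y : 'M[k]_3) : a != 0 -> 2 != 0 :> k ->
  D * D = (a ^+ 2)%:M -> D * G = G * D ->
  G * Y = - (Y * G) -> D * Y = - (Y * D) ->
  (D * G - (a ^+ 2)%:M) ^+ 3 = 0 ->
  exists2 b, b != 0 &
    (exists2 G', similar_pair G Y G' 0 & (G' - b%:M) ^+ 3 = 0) \/
    (exists p q r f1 f2 w1 w2, [/\ p * p + q * r = 0,
       f1 * p + f2 * r = 0, f1 * q - f2 * p = 0,
       p * w1 + q * w2 = 0 & r * w1 - p * w2 = 0] /\
     similar_pair G Y (mat3 (b + p) q 0 r (b - p) 0 0 0 (- b))
       (mat3 0 0 w1 0 0 w2 f1 f2 0)).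
Proof.
move=> a0 n2 DD DG GY DY DG3.
have [b [c [ba bc [P Pu DP]]]] := sign_diagonalization a0 n2 DD.
have b0 : b != 0 by rewrite -sqrf_eq0 ba sqrf_eq0.
exists b => //.
pose cj M := P^-1 * M * P.
have cjM M N : cj M * cj N = cj (M * N) by rewrite /cj !mulrA mulrK.
have cjX M : cj M ^+ 3 = cj (M ^+ 3) by rewrite !exprS expr0 !mulr1 !cjM.
have cjN M : cj (- M) = - cj M by rewrite /cj mulrN mulNr.
have cjB M N : cj (M - N) = cj M - cj N by rewrite /cj mulrBr mulrBl.
have cjc x : cj x%:M = x%:M.
  rewrite /cj; apply: (mulrI Pu); rewrite mulrA mulVKr //.
  exact/esym/scalar_mxC.
have cjD : cj D = mat3 b 0 0 0 b 0 0 0 c by rewrite /cj -mulrA DP mulKr.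
have sim : similar_pair G Y (cj G) (cj Y).
  by exists P => //; rewrite /cj !mulrA divrr // !mul1r.
have cDG : cj D * cj G = cj G * cj D by rewrite !cjM DG.
have cGY : cj G * cj Y = - (cj Y * cj G) by rewrite !cjM GY cjN.
have cDY : cj D * cj Y = - (cj Y * cj D) by rewrite !cjM DY cjN.
have cDG3 : (cj D * cj G - (b ^+ 2)%:M) ^+ 3 = 0.
  rewrite ba -(cjc (a ^+ 2)) cjM -cjB cjX DG3.
  by rewrite /cj mulr0 mul0r.
move: (cj G) (cj Y) sim cDG cGY cDY cDG3; rewrite cjD => G' Y' sim.
case: bc => ->.
  move=> _ _; rewrite -mat3_scalar => bY bG; left; exists G'.
    have -> : 0 = Y' :> 'M[k]_3; last exact: sim.
    apply/esym/eqP; move/eqP: bY.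
    have -> : b%:M * Y' = b *: Y' by exact: mul_scalar_mx.
    have -> : Y' * b%:M = b *: Y' by exact: mul_mx_scalar.
    rewrite -subr_eq0 opprK -mulr2n -scaler_nat scalerA.
    by rewrite scaler_eq0 mulf_eq0 (negPf n2) (negPf b0).
  apply/eqP; move/eqP: bG.
  have -> : b%:M * G' - (b ^+ 2)%:M = b *: (G' - b%:M).
    by rewrite scalerBr scale_scalar_mx -expr2; congr (_ - _); exact: mul_scalar_mx.
  by rewrite exprZn scaler_eq0 expf_eq0 (negPf b0).
(* This kills the entries of [G] that would not commute with [D] and those of [Y] that would not
   anticommute with it. *)
have bz l r x : l = r -> l - r = 2 * b * x -> x = 0.
  move=> -> /eqP; rewrite subrr eq_sym !mulf_eq0 (negPf n2) (negPf b0).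
  by move/eqP.
move: sim; rewrite (mat3_eta G') (mat3_eta Y').
move: (G' 0 0) (G' 0 1) (G' 0 2) (G' 1 0) (G' 1 1) (G' 1 2) (G' 2 0) (G' 2 1) (G' 2 2).
move=> g00 g01 g02 g10 g11 g12 g20 g21 g22.
move: (Y' 0 0) (Y' 0 1) (Y' 0 2) (Y' 1 0) (Y' 1 1) (Y' 1 2) (Y' 2 0) (Y' 2 1) (Y' 2 2).
move=> y00 y01 y02 y10 y11 y12 y20 y21 y22 sim.
rewrite !mat3_mul !mat3_opp.
case/mat3_inj=> -[_ _ e02] [_ _ e12] [e20 e21 _].
have z02 : g02 = 0 by apply: (bz _ _ _ e02); ring.
have z12 : g12 = 0 by apply: (bz _ _ _ e12); ring.
have z20 : g20 = 0 by apply: (bz _ _ _ (esym e20)); ring.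
have z21 : g21 = 0 by apply: (bz _ _ _ (esym e21)); ring.
move: sim; rewrite z02 z12 z20 z21.
move=> {e02 e12 e20 e21 z02 z12 z20 z21} {g02 g12 g20 g21} sim E.
case/mat3_inj=> -[d00 d01 _] [d10 d11 _] [_ _ d22].
have z00 : y00 = 0 by apply: (bz _ _ _ d00); ring.
have z01 : y01 = 0 by apply: (bz _ _ _ d01); ring.
have z10 : y10 = 0 by apply: (bz _ _ _ d10); ring.
have z11 : y11 = 0 by apply: (bz _ _ _ d11); ring.
have z22 : y22 = 0 by apply: (bz _ _ _ (esym d22)); ring.
move: sim E; rewrite z00 z01 z10 z11 z22.
move=> {d00 d01 d10 d11 d22 z00 z01 z10 z11 z22} {y00 y01 y10 y11 y22} sim.
case/mat3_inj=> -[_ _ e02] [_ _ e12] [e20 e21 _].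
rewrite mat3_scalar mat3_opp mat3_add.
rewrite !(mul0r, mulr0, addr0, add0r, oppr0).
case/mat3_cube0 => tr0 det0 t0.
(* The nilpotent matrix is [D G - b ^ 2], so the trace and determinant of its block carry factors of
   [b] to be cancelled. *)
have zb x y : x = b * y -> x = 0 -> y = 0.
  by move=> -> /eqP; rewrite mulf_eq0 (negPf b0) => /eqP.
have g11E : g11 = b - (g00 - b).
  by apply/eqP; rewrite -subr_eq0; apply/eqP; apply: zb tr0; ring.
have g22E : g22 = - b.
  apply/eqP; rewrite -subr_eq0 -oppr_eq0; apply/eqP; apply: zb t0; ring.
move: sim e02 e12 e20 e21 det0; rewrite g11E g22E.
have -> : g00 = b + (g00 - b) by rewrite addrC subrK.
move: (g00 - b) => p sim e02 e12 e20 e21 det0.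
right; exists p, g01, g10, y20, y21, y02, y12; split; last first.
  by have <- : b - (b + p - b) = b - p by ring.
have eq0 (l r x : k) : l = r -> l - r = x -> x = 0 by move=> -> <-; rewrite subrr.
split.
- by apply/eqP; rewrite -oppr_eq0; apply/eqP;
  apply: (zb _ _ (erefl (b * _))); apply: (zb _ _ _ det0); ring.
- by apply: (eq0 _ _ _ e20); ring.
- by apply: (eq0 _ _ _ e21); ring.
- by apply: (eq0 _ _ _ e02); ring.
- by apply: (eq0 _ _ _ e12); ring.
Qed.
End NormalForm.

(** The matrices behind [family3_mod], on which similarity can be stated. *)
Definition family3_data (k : fieldType) (p : family3 k) : Ldata 'M[k]_3 :=
  match p with
  | FamV a => Ldata_of (gV_unit (valP a)) (anticomm3V (val a))
  | FamC a => Ldata_of (gC_unit (valP a)) (anticomm3C (val a))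
  | FamE1 a => Ldata_of (gE_unit (valP a)) (anticomm3E1 (val a))
  | FamE2 a => Ldata_of (gE_unit (valP a)) (anticomm3E2 (val a))
  | FamE3 a b => Ldata_of (gE_unit (valP a)) (anticomm3E3 (val a) (val b))
  end.

Lemma family3_modE (k : fieldType) (p : family3 k) :
  family3_mod p = Lmod3 (family3_data p).
Proof. by case: p. Qed.

(** * The Jordan block family and rank-one idempotents *)

Section Nilpotent.
Variable k : fieldType.
Implicit Types (G Y N : 'M[k]_3).

Lemma endo3_mulmx (u1 u2 u3 x : 'cV[k]_3) :
  endo3 u1 u2 u3 *m x = x 0 0 *: u1 + x 1 0 *: u2 + x 2 0 *: u3.
Proof.
apply/colP=> i; rewrite !mxE 2!big_ord_recl big_ord1 !mxE /= addrA.
by congr (_ + _ + _); rewrite mulrC; congr (_ * _); congr (x _ 0); apply/val_inj.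
Qed.

Lemma ker0_unit (P : 'M[k]_3) :
  (forall x : 'cV_3, P *m x = 0 -> x = 0) -> P \is a GRing.unit.
Proof.
move=> kP; rewrite -[_ \is a _]/(P \in unitmx) -unitmx_tr -row_free_unit.
apply: inj_row_free => v vP; apply: trmx_inj; rewrite trmx0; apply: kP.
by apply: trmx_inj; rewrite trmx_mul trmxK vP trmx0.
Qed.

Lemma matrix_neq0 m n (M : 'M[k]_(m, n)) : M != 0 -> exists i j, M i j != 0.
Proof.
move=> M0; suff /existsP[i /existsP[j]] : [exists i, exists j, M i j != 0].
  by exists i, j.
apply: contraNT M0 => /existsPn M0; apply/eqP/matrixP=> i j.
by have := M0 i; rewrite mxE => /existsPn/(_ j)/negPn/eqP.
Qed.

(** If [N i j != 0], the vectors [N e_j] and [e_j] span a Jordan block of size 2, which splits off.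
    The projection onto it is a combination of products of [N] with the matrix unit [R], and its
    trace 2 will tell it apart from 0 and 1. *)
Lemma trace_idempotent_square0 N : N * N = 0 -> N != 0 ->
  exists E, [/\ E * E = E, E * N = N * E & \tr E = 2].
Proof.
move=> NN N0.
have [i [j nij]] := matrix_neq0 N0.
pose R : 'M[k]_3 := delta_mx j i; pose e : k := (i == j)%:R.
have RE : R = delta_mx j 0 *m (delta_mx 0 i : 'rV_3) by rewrite mul_delta_mx.
have eNe : (delta_mx 0 i : 'rV_3) *m N *m delta_mx j 0 = (N i j)%:M :> 'M_1.
  by rewrite -rowE -colE; apply/matrixP=> x y; rewrite !mxE !ord1.
have RNR : R * N * R = N i j *: R.
  rewrite -[LHS]/(R *m N *m R) {1 2}RE !mulmxA -(mulmxA _ _ N);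
  rewrite -(mulmxA _ _ (delta_mx j 0)).
  by rewrite eNe -mulmxA mul_scalar_mx -scalemxAr -RE.
(* [R] squares to 0 unless [i = j], when it is idempotent. The scalar [e] treats both cases together
   and causes the term in [C] below. *)
have RR : R * R = e *: R.
  by rewrite -[R * R]/(R *m R) mul_delta_mx_cond scaler_nat.
have trRN : \tr (R * N) = N i j.
  rewrite -[R * N]/(R *m N) RE -mulmxA mxtrace_mulC eNe.
  by rewrite /mxtrace big_ord1 mxE.
pose c := (N i j)^-1.
have sl x (M M' : 'M[k]_3) : (x *: M) * M' = x *: (M * M') by exact/esym/scalemxAl.
have sr x (M M' : 'M[k]_3) : M * (x *: M') = x *: (M * M') by exact/esym/scalemxAr.
have NA : N * (N * R) = 0 by rewrite mulrA NN mul0r.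
have NC : N * (N * R * N) = 0 by rewrite !mulrA NN !mul0r.
have BN : R * N * N = 0 by rewrite -mulrA NN mulr0.
have CN : N * R * N * N = 0 by rewrite -mulrA NN mulr0.
pose A := N * R; pose B := R * N; pose C := N * R * N.
have CE : C = N * B by rewrite /C mulrA.
have AA : A * A = N i j *: A by rewrite /A -mulrA (mulrA R) RNR sr.
have AB : A * B = e *: C by rewrite /A /B mulrA -(mulrA N) RR sr sl.
have AC : A * C = N i j *: C by rewrite /C -/A mulrA AA sl.
have BA : B * A = 0 by rewrite /B -mulrA NA mulr0.
have BB : B * B = N i j *: B by rewrite /B mulrA RNR sl.
have BC : B * C = 0 by rewrite /B -mulrA NC mulr0.
have CA : C * A = 0 by rewrite /C -mulrA NA mulr0.
have CB : C * B = N i j *: C by rewrite CE -mulrA BB sr.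
have CC : C * C = 0 by rewrite {1}/C -mulrA NC mulr0.
(* The projection onto the span of N e_j and e_j. *)
exists (c *: A + c *: B - (c ^+ 2 * e) *: C); split.
- rewrite !(mulrDl, mulrDr, mulrN, mulNr, sl, sr) AA AB AC BA BB BC CA CB CC.
  rewrite !scaler0 !scalerA !(addr0, add0r, subr0, oppr0).
  apply/matrixP=> x y; rewrite !mxE /c; by field.
- rewrite mulrBl !mulrDl mulrBr !mulrDr !sl !sr CN BN NA NC !scaler0.
  by rewrite !(addr0, add0r) mulrA.
- have trA : \tr A = N i j by rewrite -trRN; exact: mxtrace_mulC.
  have trC : \tr C = 0.
    rewrite [\tr C]mxtrace_mulC;
    exact: etrans (congr1 mxtrace NA) (mxtrace0 _ _).
  by rewrite raddfB /= mxtraceD !mxtraceZ trA trC trRN mulr0 subr0 mulVf.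
Qed.

(** Let [N = G - b]. If [N ^ 2 = 0] some nontrivial idempotent commutes with [N], against
    indecomposability. Otherwise [N ^ 2 v != 0] for some [v], and [N ^ 2 v, N v, v] is a Jordan
    basis. *)
Lemma classify_scalar_nilpotent b G : 2 != 0 :> k ->
  (G - b%:M) ^+ 3 = 0 -> indecomposable_pair G 0 -> similar_pair G 0 (gV b) (yV k).
Proof.
move=> n2 N3 ind.
have [N {}N3 GE] : exists2 N, N ^+ 3 = 0 & G = b%:M + N.
  by exists (G - b%:M) => //; rewrite addrC subrK.
have [N2|N2] := eqVneq (N * N) 0.
  have idem E : E * E = E -> E * N = N * E -> E = 0 \/ E = 1.
    move=> EE EN; apply: ind => //; last by rewrite mulr0 mul0r.
    rewrite GE mulrDr mulrDl EN; congr (_ + _); exact: scalar_mxC.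
  exfalso; have [N0|/(trace_idempotent_square0 N2) [E [EE EN trE]]] := eqVneq N 0.
    have [|||] := idem (mat3 1 0 0 0 0 0 0 0 0); rewrite ?N0 ?mulr0 ?mul0r //.
    - by rewrite mat3_mul; congr mat3; ring.
    - by rewrite mat3_0 => /mat3_inj [[/eqP]]; rewrite oner_eq0.
    - by rewrite mat3_1 => /mat3_inj [_ [_ /eqP]]; rewrite eq_sym oner_eq0.
  case: (idem E EE EN) => E0; move: trE; rewrite E0.
    by rewrite mxtrace0 => /eqP; rewrite eq_sym (negPf n2).
  rewrite mxtrace1 => /eqP; rewrite -subr_eq0 -natrB //= => /eqP.
  by move/eqP; rewrite oner_eq0.
have [v Nv] : exists v : 'cV_3, N *m (N *m v) != 0.
  have [i [j nij]] := matrix_neq0 N2; exists (delta_mx j 0).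
  apply: contraNneq nij; rewrite mulmxA -colE => /colP/(_ i).
  by rewrite [LHS]mxE [RHS]mxE => ->.
have N3v : N *m (N *m (N *m v)) = 0.
  rewrite !mulmxA -[RHS](mul0mx _ v) -N3.
  by rewrite !exprS expr0 mulr1 mulrA.
exists (endo3 (N *m (N *m v)) (N *m v) v).
  apply: ker0_unit => x; rewrite endo3_mulmx => xE.
  have x2 : x 2 0 = 0.
    move/(congr1 (fun u => N *m (N *m u))): (xE); rewrite !mulmxDr -!scalemxAr.
    rewrite N3v !mulmx0 !scaler0 !add0r => /eqP.
    by rewrite scaler_eq0 (negPf Nv) orbF => /eqP.
  have x1 : x 1 0 = 0.
    move/(congr1 (mulmx N)): (xE); rewrite x2 scale0r addr0 !mulmxDr -!scalemxAr.
    rewrite N3v mulmx0 scaler0 add0r => /eqP.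
    by rewrite scaler_eq0 (negPf Nv) orbF => /eqP.
  have x0 : x 0 0 = 0.
    move: xE; rewrite x1 x2 !scale0r !addr0 => /eqP.
    by rewrite scaler_eq0 (negPf Nv) orbF => /eqP.
  by apply/colP=> i; rewrite mxE; case: (ord3P i).
split; last first.
  by rewrite yVE mul0r mulr0.
rewrite mul_endo3 /gV mul_endo3 !mulmxDr -!scalemxAr !endo3_col /= GE !mulmxDl N3v.
by rewrite !mul_scalar_mx addr0 ![b *: _ + _]addrC.
Qed.

(** With [x] a column and [s] a row such that [s x = 1], the matrix [x s] is a projection of the
    plane onto the line of [x]. The hypotheses say that [f] vanishes on the kernel of [s] and that
    [w] lies on the line of [x]. So the module splits as the span of [x] and [e_3] plus the kernel
    of [s]. *)
Lemma graded_idempotent b (x1 x2 s1 s2 f1 f2 w1 w2 : k) :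
  s1 * x1 + s2 * x2 = 1 ->
  f1 = (f1 * x1 + f2 * x2) * s1 -> f2 = (f1 * x1 + f2 * x2) * s2 ->
  w1 = (s1 * w1 + s2 * w2) * x1 -> w2 = (s1 * w1 + s2 * w2) * x2 ->
  ~ indecomposable_pair (mat3 b 0 0 0 b 0 0 0 (- b)) (mat3 0 0 w1 0 0 w2 f1 f2 0).
Proof.
move=> sx f1E f2E w1E w2E /(_ (mat3 (x1 * s1) (x1 * s2) 0 (x2 * s1) (x2 * s2) 0 0 0 1)).
have EE u v : u * (s1 * x1 + s2 * x2) * v = u * v by rewrite sx mulr1.
case.
- rewrite mat3_mul; congr mat3; rewrite ?mulr0 ?mul0r ?addr0 ?add0r ?mulr1 //.
  + by rewrite -[RHS]EE; ring.
  + by rewrite -[RHS]EE; ring.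
  + by rewrite -[RHS]EE; ring.
  + by rewrite -[RHS]EE; ring.
- by rewrite !mat3_mul; congr mat3; ring.
- rewrite !mat3_mul; congr mat3; try ring.
  + by rewrite [in RHS]w1E; ring.
  + by rewrite [in RHS]w2E; ring.
  + by rewrite [in LHS]f1E; ring.
  + by rewrite [in LHS]f2E; ring.
- by rewrite mat3_0 => /mat3_inj[_ _ [_ _ /eqP]]; rewrite oner_eq0.
- rewrite mat3_1 => /mat3_inj[[e11 e12 _] [_ e22 _] _].
  (* A block of rank one has determinant 0, so it is not the identity. *)
  have : x1 * s1 * (x2 * s2) = x1 * s2 * (x2 * s1) by ring.
  by rewrite e11 e22 e12 mul0r mulr1 => /eqP; rewrite oner_eq0.
Qed.

End Nilpotent.

(** * Normalizing pairs with a block of size two *)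

Section Classification.
Variable k : fieldType.
Implicit Types (G Y N : 'M[k]_3).

Lemma similar_mat3 (a b c d e f g h i : k) G Y G' Y' :
  a * (e * i - f * h) - b * (d * i - f * g) + c * (d * h - e * g) != 0 ->
  G * mat3 a b c d e f g h i = mat3 a b c d e f g h i * G' ->
  Y * mat3 a b c d e f g h i = mat3 a b c d e f g h i * Y' ->
  similar_pair G Y G' Y'.
Proof. by move=> /mat3_unit Pu gP yP; exists (mat3 a b c d e f g h i). Qed.

Definition family3_similar G Y := exists p : family3 k,
  similar_pair G Y (Ld_g (family3_data p)) (Ld_y (family3_data p)).

(** Rescaling [e_3] normalizes [c] or [z] to 1 when it is nonzero, and preserves the product
    [c * z], the second parameter of [FamE3]. If both vanish, [e_3] splits off. *)
Lemma classify_jordan (b c z : k) : b != 0 ->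
  indecomposable_pair (mat3 b 1 0 0 b 0 0 0 (- b)) (mat3 0 0 z 0 0 0 0 c 0) ->
  family3_similar (mat3 b 1 0 0 b 0 0 0 (- b)) (mat3 0 0 z 0 0 0 0 c 0).
Proof.
move=> b0 ind; have [c0|c0] := eqVneq c 0; have [z0|z0] := eqVneq z 0.
- exfalso; have [||||] := ind (mat3 0 0 0 0 0 0 0 0 1).
  + by rewrite !mat3_mul; congr mat3; ring.
  + by rewrite !mat3_mul; congr mat3; ring.
  + by rewrite !mat3_mul c0 z0; congr mat3; ring.
  + by rewrite mat3_0 => /mat3_inj[_ _ [_ _ /eqP]]; rewrite oner_eq0.
  + by rewrite mat3_1 => /mat3_inj[[/eqP]]; rewrite eq_sym oner_eq0.
- exists (FamE1 (exist _ b b0)).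
  apply: (@similar_mat3 1 0 0 0 1 0 0 0 z^-1).
  + by rewrite [X in X != 0](_ : _ = z^-1) ?invr_eq0 //; ring.
  + by rewrite /= gEE !mat3_mul; congr mat3; ring.
  + by rewrite /= yE1E !mat3_mul c0; congr mat3; field.
- exists (FamE2 (exist _ b b0)).
  apply: (@similar_mat3 1 0 0 0 1 0 0 0 c).
  + by rewrite [X in X != 0](_ : _ = c) //; ring.
  + by rewrite /= gEE !mat3_mul; congr mat3; ring.
  + by rewrite /= yE2E !mat3_mul z0; congr mat3; ring.
- exists (FamE3 (exist _ b b0) (exist _ (c * z) (mulf_neq0 c0 z0))).
  apply: (@similar_mat3 1 0 0 0 1 0 0 0 c).
  + by rewrite [X in X != 0](_ : _ = c) //; ring.
  + by rewrite /= gEE !mat3_mul; congr mat3; ring.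
  + by rewrite /= yE3E !mat3_mul; congr mat3; ring.
Qed.

(** If [f w != 0], the plane is the line of [w] plus the kernel of [f], and that kernel splits off.
    If [f w = 0] with [f] or [w] zero, a suitable rank-one projection again splits the module.
    Otherwise [w] spans the kernel of [f], and [w], a vector on which [f] is 1, and [e_3] form the
    basis of the family [FamC]. *)
Lemma classify_diagonal (b f1 f2 w1 w2 : k) : b != 0 ->
  let G := mat3 b 0 0 0 b 0 0 0 (- b) in let Y := mat3 0 0 w1 0 0 w2 f1 f2 0 in
  indecomposable_pair G Y -> family3_similar G Y.
Proof.
move=> b0 G Y ind.
have idem x1 x2 s1 s2 : s1 * x1 + s2 * x2 = 1 ->
    f1 = (f1 * x1 + f2 * x2) * s1 -> f2 = (f1 * x1 + f2 * x2) * s2 ->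
    w1 = (s1 * w1 + s2 * w2) * x1 -> w2 = (s1 * w1 + s2 * w2) * x2 -> False.
  by move=> e1 e2 e3 e4 e5; apply: (graded_idempotent e1 e2 e3 e4 e5 ind).
have [fw0|fw0] := eqVneq (f1 * w1 + f2 * w2) 0; last first.
  exfalso; apply: (idem w1 w2 (f1 / (f1 * w1 + f2 * w2)) (f2 / (f1 * w1 + f2 * w2)));
    by field.
have [f10|f10] := eqVneq f1 0; have [f20|f20] := eqVneq f2 0.
- exfalso; have [w10|w10] := eqVneq w1 0; have [w20|w20] := eqVneq w2 0.
  + by apply: (idem 1 0 1 0); rewrite ?f10 ?f20 ?w10 ?w20; ring.
  + by apply: (idem w1 w2 0 w2^-1); rewrite ?f10 ?f20 ?w10 ?w20; field.
  + by apply: (idem w1 w2 w1^-1 0); rewrite ?f10 ?f20 ?w10 ?w20; field.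
  + by apply: (idem w1 w2 w1^-1 0); rewrite ?f10 ?f20; field.
- have w20 : w2 = 0.
    by apply/eqP; move/eqP: fw0; rewrite f10 mul0r add0r mulf_eq0 (negPf f20).
  have [w10|w10] := eqVneq w1 0.
    by exfalso; apply: (idem 0 f2^-1 f1 f2); rewrite ?f10 ?w20 ?w10; field.
  exists (FamC (exist _ b b0)).
  apply: (@similar_mat3 w1 0 0 0 f2^-1 0 0 0 1).
  + by rewrite [X in X != 0](_ : _ = w1 / f2) ?mulf_neq0 ?invr_eq0 //; ring.
  + by rewrite /= gCE !mat3_mul; congr mat3; ring.
  + by rewrite /= yCE !mat3_mul f10 w20; congr mat3; field.
- have w10 : w1 = 0.
    by apply/eqP; move/eqP: fw0; rewrite f20 mul0r addr0 mulf_eq0 (negPf f10).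
  have [w20|w20] := eqVneq w2 0.
    by exfalso; apply: (idem f1^-1 0 f1 f2); rewrite ?f20 ?w20 ?w10; field.
  exists (FamC (exist _ b b0)).
  apply: (@similar_mat3 0 f1^-1 0 w2 0 0 0 0 1).
  + by rewrite [X in X != 0](_ : _ = - (w2 / f1)) ?oppr_eq0 ?mulf_neq0 ?invr_eq0 //; ring.
  + by rewrite /= gCE !mat3_mul; congr mat3; ring.
  + by rewrite /= yCE !mat3_mul f20 w10; congr mat3; field.
- have w1E : w1 = - (f2 * w2 / f1).
    apply: (mulfI f10); rewrite mulrN mulrCA divff // mulr1; apply/eqP.
    by rewrite -addr_eq0 fw0.
  have [w20|w20] := eqVneq w2 0.
    by exfalso; apply: (idem f1^-1 0 f1 f2); rewrite ?w1E ?w20; field.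
  exists (FamC (exist _ b b0)).
  apply: (@similar_mat3 w1 f1^-1 0 w2 0 0 0 0 1).
  + by rewrite [X in X != 0](_ : _ = - (w2 / f1)) ?oppr_eq0 ?mulf_neq0 ?invr_eq0 //; ring.
  + by rewrite /= gCE !mat3_mul; congr mat3; ring.
  + by rewrite /= yCE !mat3_mul w1E; congr mat3; field.
Qed.

(** A nonzero [N] is put in Jordan form by a basis [N u, u] of the plane. Then [f N = 0] and
    [N w = 0] leave a single entry in each of [f] and [w]. *)
Lemma classify_graded (b p q r f1 f2 w1 w2 : k) : b != 0 ->
  [/\ p * p + q * r = 0, f1 * p + f2 * r = 0, f1 * q - f2 * p = 0,
     p * w1 + q * w2 = 0 & r * w1 - p * w2 = 0] ->
  let G := mat3 (b + p) q 0 r (b - p) 0 0 0 (- b) in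
  let Y := mat3 0 0 w1 0 0 w2 f1 f2 0 in
  indecomposable_pair G Y -> family3_similar G Y.
Proof.
move=> b0 [pq fp fq pw rw] G Y ind.
suff [[p0 q0 r0]|[c [z sim]]] : [/\ p = 0, q = 0 & r = 0] \/ exists c z,
    similar_pair G Y (mat3 b 1 0 0 b 0 0 0 (- b)) (mat3 0 0 z 0 0 0 0 c 0).
- move: ind; rewrite /G p0 q0 r0 addr0 subr0; exact: classify_diagonal.
- have [x sx] := classify_jordan b0 (indecomposable_similar sim ind).
  by exists x; apply: similar_pair_trans sim sx.
have [r0|r0] := eqVneq r 0.
  have p0 : p = 0.
    by apply/eqP; move/eqP: pq; rewrite r0 mulr0 addr0 mulf_eq0 orbb.
  have [q0|q0] := eqVneq q 0; [by left|right].
  have f10 : f1 = 0.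
    by apply/eqP; move/eqP: fq; rewrite p0 mulr0 subr0 mulf_eq0 (negPf q0) orbF.
  have w20 : w2 = 0.
    by apply/eqP; move/eqP: pw; rewrite p0 mul0r add0r mulf_eq0 (negPf q0).
  (* Here [u = e_2] and [N u = q e_1]. *)
  exists f2, (w1 / q); apply: (@similar_mat3 q 0 0 0 1 0 0 0 1).
  + by rewrite [X in X != 0](_ : _ = q) //; ring.
  + by rewrite /G !mat3_mul r0 p0; congr mat3; ring.
  + by rewrite /Y !mat3_mul f10 w20; congr mat3; field.
right; exists f1, (w2 / r).
have f2E : f2 = - (f1 * p / r).
  apply: (mulIf r0); rewrite mulNr mulfVK //; apply/eqP.
  by rewrite -addr_eq0 addrC fp.
have w1E : w1 = p * w2 / r.
  apply: (mulIf r0); rewrite mulfVK //; apply/eqP; rewrite -subr_eq0 mulrC rw.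
  by [].
have qE : q = - (p * p / r).
  apply: (mulIf r0); rewrite mulNr mulfVK //; apply/eqP.
  by rewrite -addr_eq0 addrC pq.
(* Here [u = e_1], and [N u] has coordinates [p] and [r]. *)
apply: (@similar_mat3 p 1 0 r 0 0 0 0 1).
+ by rewrite [X in X != 0](_ : _ = - r) ?oppr_eq0 //; ring.
+ by rewrite /G !mat3_mul qE; congr mat3; field.
+ by rewrite /Y !mat3_mul f2E w1E; congr mat3; field.
Qed.

End Classification.

Lemma indecomposable_pair_family3 (k : closedFieldType) (hk : [pchar k] =i pred0)
    (G Y : 'M[k]_3) :
  G \is a GRing.unit -> G * Y = - (Y * G) -> indecomposable_pair G Y ->
  family3_similar G Y.
Proof.
move=> Gu GY ind.
have n2 : 2 != 0 :> k by move/pcharf0P: hk => ->.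
have [a a0 [D [DD DG DY DG3]]] := anticomm_grading hk Gu GY ind.
have [b b0 [[G' sim N3]|[p [q [r [f1 [f2 [w1 [w2 [E sim]]]]]]]]]] :=
  grading_normal_form a0 n2 DD DG GY DY DG3.
- exists (FamV (exist _ b b0)); apply: (similar_pair_trans sim).
  exact: classify_scalar_nilpotent n2 N3 (indecomposable_similar sim ind).
- have [x sx] := classify_graded b0 E (indecomposable_similar sim ind).
  by exists x; apply: similar_pair_trans sim sx.
Qed.

(** * Indecomposability of the five families *)

Section FamilyIndecomposable.
Variable k : fieldType.
Implicit Types (G Y N : 'M[k]_3).

Lemma similar_pair_sym G Y G' Y' :
  similar_pair G Y G' Y' -> similar_pair G' Y' G Y.
Proof.
case=> P Pu [gP yP]; exists P^-1; first by rewrite unitrV.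
by split; apply: (mulrI Pu); rewrite mulVKr // mulrA -?gP -?yP mulrK.
Qed.

(** Every nonzero submodule contains [w], so two of them never meet trivially. *)
Lemma simple_socle_indecomposable (R : nzRingType) (V : lmodType R) (w : V) :
  w != 0 -> (forall v, v != 0 -> exists x : R, x *: v = w) -> indecomposable V.
Proof.
move=> w0 soc; split=> [|A B sA sB AB0 _]; first by exists w.
have memw (C : {pred V}) :
    submod_closed C -> (forall v, v \in C -> v = 0) \/ w \in C.
  move=> [C0 CP].
  have [C1|/existsNP[v /not_implyP[vC v0]]] :=
    pselect (forall v, v \in C -> v = 0).
    by left.
  right; have [|x <-] := soc v; first exact/eqP.
  by rewrite -[x *: v]addr0; apply: CP.
have [|wA] := memw A sA; first by left.
have [|wB] := memw B sB; first by right.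
by case/eqP: w0; apply: AB0.
Qed.

(** If [u = a + b] and [phi u != 0], then [phi] is nonzero on [a] or on [b], so one of the two
    summands is everything. This serves [modE2], where [k e_1] and [k e_3] are both submodules and
    the preceding criterion fails. *)
Lemma cyclic_indecomposable (R : nzRingType) (V : lmodType R) (U : zmodType)
    (phi : {additive V -> U}) :
  (exists v, phi v != 0) ->
  (forall A : {pred V}, submod_closed A ->
     forall v, v \in A -> phi v != 0 -> forall w, w \in A) ->
  indecomposable V.
Proof.
move=> [u u0] gen; split=> [|A B sA sB AB0 AB].
  by exists u; apply: contra_neq u0 => ->; rewrite raddf0.
have [a [b [aA bB uE]]] := AB u.
have [a0|a0] := eqVneq (phi a) 0.
- left=> v vA; apply: AB0 => //; apply: (gen B sB b) => //.
  by apply: contra_neq u0 => b0; rewrite uE raddfD a0 b0 addr0.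
- by right=> v vB; apply: AB0 => //; apply: (gen A sA a).
Qed.

Definition col3 (x y z : k) : 'cV[k]_3 := \col_i nth 0 [:: x; y; z] i.

Lemma col3_eta (v : 'cV[k]_3) : v = col3 (v 0 0) (v 1 0) (v 2 0).
Proof. by apply/colP=> i; rewrite mxE; case: (ord3P i). Qed.

Lemma col3_0 : 0 = col3 0 0 0.
Proof. by rewrite [LHS]col3_eta !mxE. Qed.

Lemma col3_add x y z x' y' z' :
  col3 x y z + col3 x' y' z' = col3 (x + x') (y + y') (z + z').
Proof. by apply/colP=> i; rewrite !mxE; case: (ord3P i). Qed.

Lemma col3_scale c x y z : c *: col3 x y z = col3 (c * x) (c * y) (c * z).
Proof. by apply/colP=> i; rewrite !mxE; case: (ord3P i). Qed.

Lemma mat3_col a b c d e f g h i x y z :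
  mat3 a b c d e f g h i *m col3 x y z =
  col3 (a * x + b * y + c * z) (d * x + e * y + f * z) (g * x + h * y + i * z).
Proof.
apply/colP=> r; rewrite !mxE 2!big_ord_recl big_ord1 !mxE /=.
by case: (ord3P r); rewrite /= addrA.
Qed.

Lemma e1_socle_indecomposable (d : Ldata 'M[k]_3) :
  (forall v : 'cV_3, v != 0 -> exists (x : L k) (c : k), c != 0 /\
     Llift d x *m v = col3 c 0 0) -> indecomposable (Lmod3 d).
Proof.
move=> soc; apply: (@simple_socle_indecomposable _ (Lmod3 d) (col3 1 0 0)).
  by apply/eqP=> /colP/(_ 0); rewrite !mxE => /eqP; rewrite oner_eq0.
move=> v /soc[x [c [c0 xv]]]; exists ((c^-1)%:A * x).
by rewrite -scalerA cstLmod3 scaleLmod3 xv col3_scale !mulr0 mulVf.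
Qed.

Lemma LliftB (d1 : Ldata 'M[k]_3) x y :
  Llift d1 (x - y) = Llift d1 x - Llift d1 y.
Proof. exact: rmorphB. Qed.

Lemma LliftM (d1 : Ldata 'M[k]_3) x y :
  Llift d1 (x * y) = Llift d1 x * Llift d1 y.
Proof. exact: rmorphM. Qed.

Let liftE := (Llift_cst, Llift_g, Llift_y, LliftB, LliftM).

Lemma col3_neq0 x y z : col3 x y z != 0 -> [\/ x != 0, y != 0 | z != 0].
Proof.
have [->|] := eqVneq x 0; last by constructor 1.
have [->|] := eqVneq y 0; last by constructor 2.
have [->|] := eqVneq z 0; last by constructor 3.
by rewrite -col3_0 eqxx.
Qed.

Lemma modV_indecomposable (a : {a : k | a != 0}) : indecomposable (modV a).
Proof.
apply: e1_socle_indecomposable => v; rewrite (col3_eta v).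
move: (v 0 0) (v 1 0) (v 2 0) => x y z v0.
(* [n] sends [e_3] to [e_2], [e_2] to [e_1] and [e_1] to 0, so a power of it moves the last nonzero
   coordinate to [e_1]. *)
pose n : L k := Lg k - (val a)%:A.
have [z0|z0] := eqVneq z 0; first have [y0|y0] := eqVneq y 0.
- exists 1, x; rewrite rmorph1 mul1mx y0 z0; split=> //.
  by case/col3_neq0: v0; rewrite ?y0 ?z0 ?eqxx.
- exists n, y; split=> //.
  rewrite /n !liftE /= gVE mat3_scalar mat3_opp mat3_add mat3_col z0.
  by congr col3; ring.
- exists (n * n), z; split=> //.
  rewrite /n !liftE /= gVE mat3_scalar mat3_opp mat3_add -mulmxA !mat3_col.
  by congr col3; ring.
Qed.

(** Here [y] acts along the chain [e_2, e_3, e_1, 0], so its powers reach [e_1]. *)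
Lemma modC_indecomposable (a : {a : k | a != 0}) : indecomposable (modC a).
Proof.
apply: e1_socle_indecomposable => v; rewrite (col3_eta v).
move: (v 0 0) (v 1 0) (v 2 0) => x y z v0.
have [y0|y0] := eqVneq y 0; first have [z0|z0] := eqVneq z 0.
- exists 1, x; rewrite rmorph1 mul1mx y0 z0; split=> //.
  by case/col3_neq0: v0; rewrite ?y0 ?z0 ?eqxx.
- exists (Ly k), z; split=> //.
  by rewrite !liftE /= yCE mat3_col y0; congr col3; ring.
- exists (Ly k * Ly k), y; split=> //.
  by rewrite !liftE /= yCE -mulmxA !mat3_col; congr col3; ring.
Qed.

Lemma modE1_indecomposable (a : {a : k | a != 0}) : indecomposable (modE1 a).
Proof.
apply: e1_socle_indecomposable => v; rewrite (col3_eta v).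
move: (v 0 0) (v 1 0) (v 2 0) => x y z v0.
have [z0|z0] := eqVneq z 0; first have [y0|y0] := eqVneq y 0.
- exists 1, x; rewrite rmorph1 mul1mx y0 z0; split=> //.
  by case/col3_neq0: v0; rewrite ?y0 ?z0 ?eqxx.
- exists (Lg k - (val a)%:A), y; split=> //.
  rewrite !liftE /= gEE mat3_scalar mat3_opp mat3_add mat3_col z0.
  by congr col3; ring.
- exists (Ly k), z; split=> //.
  by rewrite !liftE /= yE1E mat3_col; congr col3; ring.
Qed.

Lemma modE3_indecomposable (a b : {a : k | a != 0}) : indecomposable (modE3 a b).
Proof.
apply: e1_socle_indecomposable => v; rewrite (col3_eta v).
move: (v 0 0) (v 1 0) (v 2 0) => x y z v0.
have [y0|y0] := eqVneq y 0; first have [z0|z0] := eqVneq z 0.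
- exists 1, x; rewrite rmorph1 mul1mx y0 z0; split=> //.
  by case/col3_neq0: v0; rewrite ?y0 ?z0 ?eqxx.
- exists (Ly k), (val b * z); split; first by rewrite mulf_neq0 // (valP b).
  by rewrite !liftE /= yE3E mat3_col y0; congr col3; ring.
- exists (Ly k * Ly k), (val b * y); split; first by rewrite mulf_neq0 // (valP b).
  by rewrite !liftE /= yE3E -mulmxA !mat3_col; congr col3; ring.
Qed.

(** A vector with nonzero second coordinate yields a multiple of [e_3] under [y]. Applying [g - a]
    and correcting by [e_3] yields [e_1], and then the vector itself supplies [e_2]. *)
Lemma modE2_indecomposable (a : {a : k | a != 0}) : indecomposable (modE2 a).
Proof.
have phiB : zmod_morphism (fun v : modE2 a => (v : 'cV[k]_3) 1 0).
  by move=> u v; rewrite !mxE.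
pose phi : {additive modE2 a -> k} :=
  HB.pack (fun v : modE2 a => (v : 'cV[k]_3) 1 0)
    (GRing.isZmodMorphism.Build _ _ _ phiB).
apply: (@cyclic_indecomposable _ _ _ phi).
  by exists (col3 0 1 0); rewrite /= mxE /= oner_eq0.
move=> A [A0 AP] v vA; rewrite /= => v10 w.
have AZ (x : L k) u : u \in A -> x *: u \in A.
  by move=> uA; rewrite -[x *: u]addr0; apply: AP.
have AZc (c : k) u : u \in A -> c *: (u : 'cV_3) \in A.
  by move=> uA; rewrite -cstLmod3; apply: AZ.
have AD u u' : u \in A -> u' \in A -> u + u' \in A.
  by move=> uA u'A; rewrite -[u]scale1r; apply: AP.
move: v10 vA; rewrite (col3_eta v); move: (v 0 0) (v 1 0) (v 2 0) => x y z.
rewrite mxE /= => y0 vA.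
have e3A : col3 0 0 1 \in A.
  have -> : col3 0 0 1 = y^-1 *: (Ly k *: (col3 x y z : modE2 a) : 'cV_3).
    by rewrite yLmod3 /= yE2E mat3_col col3_scale; congr col3; field.
  by apply/AZc/AZ.
have e1A : col3 1 0 0 \in A.
  have -> : col3 1 0 0 = y^-1 *: col3 y 0 0 by rewrite col3_scale mulVf // mulr0.
  apply: (AZc).
  have -> : col3 y 0 0 = (Lg k - (val a)%:A) *: (col3 x y z : modE2 a)
      + ((2 * val a * z) *: col3 0 0 1 : 'cV_3).
    rewrite scaleLmod3 !liftE /= gEE mat3_scalar mat3_opp mat3_add mat3_col.
    by rewrite col3_scale [RHS]col3_add; congr col3; ring.
  by apply: AD; [apply: AZ|apply: AZc].
have -> : w = w 0 0 *: col3 1 0 0 + w 2 0 *: col3 0 0 1 +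
    (w 1 0 / y) *: (col3 x y z + (- x) *: col3 1 0 0 + (- z) *: col3 0 0 1).
  by rewrite {1}(col3_eta w) !(col3_scale, col3_add); congr col3; field.
apply: (AD); first by apply: (AD); apply: (AZc).
apply: (AZc); apply: (AD); last exact: AZc.
by apply: (AD) => //; apply: (AZc).
Qed.
End FamilyIndecomposable.

(** * Invariants separating the families and their parameters *)

Section FamilyUnique.
Variable k : fieldType.
Implicit Types (G Y N : 'M[k]_3) (a b c : k).

Lemma similar_trace G Y G' Y' : similar_pair G Y G' Y' -> \tr G = \tr G'.
Proof.
case=> P Pu [gP _].
have -> : G' = P^-1 *m (G *m P).
  by rewrite (gP : G *m P = P *m G'); exact/esym/mulKr.
by rewrite mxtrace_mulC -mulmxA (divrr Pu : P *m P^-1 = 1%:M) mulmx1.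
Qed.

Lemma similar_det G Y G' Y' : similar_pair G Y G' Y' -> \det G = \det G'.
Proof.
case=> P Pu [gP _]; have := congr1 determinant gP.
rewrite -[G * P]/(G *m P) -[P * G']/(P *m G') !det_mulmx mulrC; apply: mulfI.
by move: Pu; rewrite -[_ \is a _]/(P \in unitmx) unitmxE unitfE.
Qed.

Lemma similar_square G Y G' Y' c : similar_pair G Y G' Y' ->
  G * G = c%:M -> G' * G' = c%:M.
Proof.
case=> P Pu [gP _] GG; apply: (mulrI Pu).
rewrite mulrA -gP -mulrA -gP mulrA GG; exact/esym/scalar_mxC.
Qed.

(** The coefficient [c] is the invariant that detects the second parameter of [FamE3]. *)
Lemma similar_ysquare G Y G' Y' c d : similar_pair G Y G' Y' ->
  Y * Y = c *: (G * G - d%:M) -> Y' * Y' = c *: (G' * G' - d%:M).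
Proof.
case=> P Pu [gP yP] YY; apply: (mulrI Pu).
rewrite mulrA -yP -mulrA -yP mulrA YY;
rewrite -[LHS]scalemxAl -[RHS]scalemxAr; congr (_ *: _).
rewrite -[LHS]/((G * G - d%:M) * P) -[RHS]/(P * (G' * G' - d%:M)).
rewrite mulrBl mulrBr [P * (G' * G')]mulrA -gP -!mulrA -gP; congr (_ - _).
exact/esym/scalar_mxC.
Qed.

Lemma similar_annihilator G Y G' Y' c : similar_pair G Y G' Y' ->
  (G - c%:M) * Y = 0 -> (G' - c%:M) * Y' = 0.
Proof.
case=> P Pu [gP yP] GY; apply: (mulrI Pu).
rewrite mulr0 mulrA mulrBr -gP.
have -> : P * c%:M = c%:M * P by apply: scalar_mxC.
by rewrite -mulrBl -mulrA -yP mulrA GY mul0r.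
Qed.

Lemma family3_trace (p : family3 k) :
  \tr (Ld_g (family3_data p)) =
  match p with
  | FamV a => 3 * val a
  | FamC a | FamE1 a | FamE2 a | FamE3 a _ => val a
  end.
Proof.
by case: p => * /=; rewrite ?gVE ?gCE ?gEE /mxtrace
  2!big_ord_recl big_ord1 !mxE /=; ring.
Qed.

Lemma det_mat3_upper a b c e f i : \det (mat3 a b c 0 e f 0 0 i) = a * e * i.
Proof.
rewrite -det_tr det_trig; last first.
  by apply/is_trig_mxP=> r s; case: (ord3P r); case: (ord3P s); rewrite // !mxE.
by rewrite 2!big_ord_recl big_ord1 !mxE /= mulrA.
Qed.

Lemma family3_det (p : family3 k) :
  \det (Ld_g (family3_data p)) =
  match p with
  | FamV a => val a ^+ 3
  | FamC a | FamE1 a | FamE2 a | FamE3 a _ => - val a ^+ 3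
  end.
Proof. by case: p => * /=; rewrite ?gVE ?gCE ?gEE det_mat3_upper; ring. Qed.

Lemma gC_square a : gC a * gC a = (a ^+ 2)%:M.
Proof. by rewrite gCE mat3_mul mat3_scalar; congr mat3; ring. Qed.

Lemma gE_square a c : 2 != 0 :> k -> a != 0 -> gE a * gE a != c%:M.
Proof.
move=> n2 a0; apply/eqP; rewrite gEE mat3_mul mat3_scalar => /mat3_inj[[_ e _] _ _].
have : 2 * a = 0 by rewrite -e; ring.
by move/eqP; rewrite mulf_eq0 (negPf n2) (negPf a0).
Qed.

Lemma gE_yE1 a : (gE a - a%:M) * yE1 k = 0.
Proof.
rewrite gEE yE1E mat3_scalar mat3_opp mat3_add mat3_mul mat3_0.
by congr mat3; ring.
Qed.

(** Both [yE3 b] squared and [gE a] squared minus [a ^ 2] are multiples of the matrix unit sending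
    [e_2] to [e_1], with coefficients [b] and [2 a]. *)
Lemma yE3_square a b c :
  yE3 b * yE3 b = c *: (gE a * gE a - (a ^+ 2)%:M) -> b = 2 * a * c.
Proof.
rewrite yE3E gEE mat3_scalar !mat3_mul mat3_opp mat3_add => /matrixP/(_ 0 1).
by rewrite !mxE /= => e; transitivity (0 * 0 + 0 * 0 + b * 1); [ring|rewrite e; ring].
Qed.

Lemma yE3_squareE a b : 2 != 0 :> k -> a != 0 ->
  yE3 b * yE3 b = (b / (2 * a)) *: (gE a * gE a - (a ^+ 2)%:M).
Proof.
move=> n2 a0; rewrite yE3E gEE mat3_scalar !mat3_mul mat3_opp mat3_add.
apply/matrixP=> i j; rewrite !mxE; case: (ord3P i); case: (ord3P j) => /=;
  by field; rewrite n2 a0.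
Qed.

Lemma family3_similar_eq (p q : family3 k) : [pchar k] =i pred0 ->
  similar_pair (Ld_g (family3_data p)) (Ld_y (family3_data p))
               (Ld_g (family3_data q)) (Ld_y (family3_data q)) -> p = q.
Proof.
move=> /pcharf0P ch sim; have n2 : 2 != 0 :> k by rewrite ch.
have n3 : 3 != 0 :> k by rewrite ch.
(* This separates [FamV] from the rest: trace and determinant would give [a ^ 3 = - (3 a) ^ 3], that
   is [28 a ^ 3 = 0]. *)
have VX a c : a != 0 -> 3 * a = c -> a ^+ 3 = - c ^+ 3 -> False.
  move=> a0 <- e; have : 28 * a ^+ 3 = 0.
    by transitivity (a ^+ 3 + (3 * a) ^+ 3); [ring|rewrite {1}e addNr].
  by move/eqP; rewrite mulf_eq0 expf_eq0 ch (negPf a0).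
have := similar_trace sim; have := similar_det sim.
rewrite !family3_trace !family3_det => dE tE; have msi := similar_pair_sym sim.
have CE (a a' : {a : k | a != 0}) Y Y' :
    similar_pair (gC (val a)) Y (gE (val a')) Y' -> False.
  by move/similar_square => /(_ _ (gC_square _)); apply/eqP/gE_square/(valP a').
(* For [FamE1] and [FamE2] the relation on [Y ^ 2] holds with [c = 0], which [FamE3] excludes. *)
have yE1sq b : yE1 k * yE1 k = 0 *: (gE b * gE b - (b ^+ 2)%:M).
  by rewrite scale0r yE1E mat3_mul mat3_0; congr mat3; ring.
have yE2sq b : yE2 k * yE2 k = 0 *: (gE b * gE b - (b ^+ 2)%:M).
  by rewrite scale0r yE2E mat3_mul mat3_0; congr mat3; ring.
have E12 a : a != 0 -> similar_pair (gE a) (yE1 k) (gE a) (yE2 k) -> False.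
  move=> a0 /similar_annihilator => /(_ a); rewrite gE_yE1 => /(_ erefl).
  rewrite gEE yE2E mat3_scalar mat3_opp mat3_add mat3_mul mat3_0.
  case/mat3_inj=> _ _ [_ e _].
  have : 2 * a = 0 by rewrite -[RHS]oppr0 -e; ring.
  by move/eqP; rewrite mulf_eq0 (negPf n2) (negPf a0).
have E3 a b c : b != 0 ->
    yE3 b * yE3 b = c *: (gE a * gE a - (a ^+ 2)%:M) -> c != 0.
  by move=> b0 /yE3_square e; apply: contraNneq b0 => c0; rewrite e c0 mulr0.
move: sim msi dE tE; case: p => [a|a|a|a|a b]; case: q => [a'|a'|a'|a'|a' b'] /=;
  move=> sim msi dE tE;
  try (by case: (VX _ _ (valP a) tE dE));
  try (by case: (VX _ _ (valP a') (esym tE) (esym dE)));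
  try (by case: (CE _ _ _ _ sim)); try (by case: (CE _ _ _ _ msi)).
- by congr FamV; apply: val_inj; apply: (mulfI n3).
- by congr FamC; apply: val_inj.
- by congr FamE1; apply: val_inj.
- by move: sim; rewrite -tE => /(E12 _ (valP a)).
- have := similar_ysquare sim (yE1sq (val a)).
  by rewrite /= tE => /(E3 _ _ _ (valP b')); rewrite eqxx.
- by move: msi; rewrite -tE => /(E12 _ (valP a)).
- by congr FamE2; apply: val_inj.
- have := similar_ysquare sim (yE2sq (val a)).
  by rewrite /= tE => /(E3 _ _ _ (valP b')); rewrite eqxx.
- have := similar_ysquare msi (yE1sq (val a')).
  by rewrite /= -tE => /(E3 _ _ _ (valP b)); rewrite eqxx.
- have := similar_ysquare msi (yE2sq (val a')).
  by rewrite /= -tE => /(E3 _ _ _ (valP b)); rewrite eqxx.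
- have aa : a = a' by apply: val_inj.
  congr FamE3 => //; apply: val_inj.
  have := similar_ysquare sim (yE3_squareE _ n2 (valP a)).
  rewrite aa => /yE3_square/esym; apply: etrans.
  by rewrite [RHS]mulrC mulfVK // mulf_neq0 // (valP a').
Qed.
End FamilyUnique.

Theorem proposition2p16 (k : closedFieldType) (hk : [pchar k] =i pred0)
    (V : lmodType (L k)) (hV : has_kdim V 3) :
  indecomposable V <-> exists! p : family3 k, mod_iso V (family3_mod p).
Proof.
split=> [indV|[p [Vp _]]]; last first.
  apply: indecomposable_iso (mod_iso_sym Vp) _; case: p {Vp} => *.
  - exact: modV_indecomposable.
  - exact: modC_indecomposable.
  - exact: modE1_indecomposable.
  - exact: modE2_indecomposable.
  - exact: modE3_indecomposable.
have [d Vd] := has_kdim_Lmod3 hV.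
have indd := indecomposable_Lmod3_pair (indecomposable_iso Vd indV).
have gu : Ld_g d \is a GRing.unit.
  by apply/unitrP; exists (Ld_gi d); rewrite Ld_gV Ld_Vg.
have gy : Ld_g d * Ld_y d = - (Ld_y d * Ld_g d).
  by rewrite -mulNr -(Ld_gyV d) -!mulrA Ld_Vg mulr1.
have [p dp] := indecomposable_pair_family3 hk gu gy indd.
exists p; split=> [|q Vq].
  by rewrite family3_modE; apply: mod_iso_trans Vd (similar_pair_iso dp).
(* Two families isomorphic to [V] have similar pairs of matrices, hence coincide. *)
apply: (family3_similar_eq hk); apply: (similar_pair_trans (similar_pair_sym dp)).
apply: iso_similar_pair; rewrite -family3_modE.
exact: mod_iso_trans (mod_iso_sym Vd) Vq.
Qed.
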